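(* Let $H:\mathbb{R}\to[0,\infty)$ be a symmetric convex function such that $H(x)=\tfrac14 x^2$ for $x\in[-2t_0,2t_0]$ for some $t_0>0$, and let $H^*:\mathbb{R}\to[0,\infty)$ be its Fenchel--Legendre transform, $H^*(x)=\sup_{y\in\mathbb{R}}\{xy-H(y)\}$. Suppose moreover that $\lim_{x\to\infty}H^*(x)/x=\infty$ and that there exist $A\in[1,\infty)$ and $\alpha\in(1,2]$ such that $$H(sx)\le A s^{\alpha}H(x)\quad\text{for all } x\in\mathbb{R},\ s\in[0,1].$$ Denote $\theta(t)=H^*(t)$ for $t\ge 0$. For a Borel probability measure $\mu$ on $\mathbb{R}$ the following conditions are equivalent. (i) For every $s>0$ we have $\int_{\mathbb{R}}e^{s|x|}\,d\mu(x)<\infty$, and there exists $c>0$ such that $$\operatorname{Ent}_\mu(e^{\varphi})\le\int_{\mathbb{R}}H(c\varphi')e^{\varphi}\,d\mu$$ for every smooth convex Lipschitz function $\varphi:\mathbb{R}\to\mathbb{R}$. (ii) There exists $b>0$ such that for all $h>0$, $$\Delta_\mu(h)\le\frac1b\,\theta^{-1}(t_0^2+h).$$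
   Context: For a non-negative function $g$, $\operatorname{Ent}_\mu(g)=\int g\ln g\,d\mu-\int g\,d\mu\,\ln\bigl(\int g\,d\mu\bigr)$ if $\int g\ln g\,d\mu<\infty$, and $\operatorname{Ent}_\mu(g)=\infty$ otherwise. Let $\tau$ be the symmetric exponential probability measure on $\mathbb{R}$ with density $\tfrac12e^{-|x|}$, $F_\tau$ its distribution function, $F_\mu(x)=\mu((-\infty,x])$, and $F_\mu^{-1}(t)=\inf\{y\in\mathbb{R}:F_\mu(y)\ge t\}\in\mathbb{R}\cup\{\pm\infty\}$ for $t\in[0,1]$. Let $U_\mu=F_\mu^{-1}\circ F_\tau$, i.e. $U_\mu(x)=F_\mu^{-1}(\tfrac12e^{-|x|})$ for $x<0$ and $U_\mu(x)=F_\mu^{-1}(1-\tfrac12e^{-|x|})$ for $x\ge0$ (the unique left-continuous non-decreasing map transporting $\tau$ onto $\mu$). For $h>0$, $\Delta_\mu(h)=\sup_{x\in\mathbb{R}}\{U_\mu(x+h)-U_\mu(x)\}$. $\theta^{-1}$ denotes the inverse of the increasing function $\theta$ on $[0,\infty)$. *)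

(* Defs.v *)
From HB Require Import structures.
From mathcomp Require Import all_boot all_order all_algebra.
From mathcomp Require Import all_classical all_reals all_analysis.
Set Implicit Arguments. Unset Strict Implicit. Unset Printing Implicit Defensive.
Import Order.TTheory GRing.Theory Num.Theory.
Import numFieldNormedType.Exports.
Local Open Scope classical_set_scope.
Local Open Scope ring_scope.

Section Defs.
Variable R : realType.

Definition convex_fun (f : R -> R) : Prop :=
  forall x y t : R, 0 <= t -> t <= 1 ->
    f (t * x + (1 - t) * y) <= t * f x + (1 - t) * f y.

Definition legendre (H : R -> R) (x : R) : R :=
  sup [set x * y - H y | y in [set: R]].

Definition inv_nonneg (theta : R -> R) (u : R) : R :=
  xget 0 [set t | 0 <= t /\ theta t = u].

Definition smooth (f : R -> R) : Prop :=
  forall (n : nat) (x : R), derivable (derive1n n f) x 1.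

Definition distF (mu : probability R R) (x : R) : R :=
  fine (mu `]-oo, x]%classic).

(* F_mu^{-1}(t) = inf {y : F_mu(y) >= t}, used only for t in (0,1) *)
Definition quantile (mu : probability R R) (t : R) : R :=
  inf [set y | t <= distF mu y].

(* distribution function of the symmetric exponential law *)
Definition F_tau (x : R) : R :=
  if x < 0 then 2^-1 * expR (- `|x|) else 1 - 2^-1 * expR (- `|x|).

Definition U_map (mu : probability R R) (x : R) : R := quantile mu (F_tau x).

Definition Delta (mu : probability R R) (h : R) : \bar R :=
  ereal_sup [set (U_map mu (x + h) - U_map mu x)%:E | x in [set: R]].

Definition Ent (mu : probability R R) (g : R -> R) : \bar R :=
  let I := (\int[mu]_x (g x * ln (g x))%:E)%E in
  let J := fine (\int[mu]_x (g x)%:E)%E in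
  if (I < +oo)%E then (I - (J * ln J)%:E)%E else +oo%E.

End Defs.

(* Main.v *)
Require Import Defs.
From HB Require Import structures.
From mathcomp Require Import all_boot all_order all_algebra.
From mathcomp Require Import all_classical all_reals all_analysis.
From mathcomp Require Import measurable_realfun ring lra.
Set Implicit Arguments. Unset Strict Implicit. Unset Printing Implicit Defensive.
Import Order.TTheory GRing.Theory Num.Theory.
Import numFieldNormedType.Exports.
Local Open Scope classical_set_scope.
Local Open Scope ring_scope.

(* For one direction, apply the inequality to l * s(sgn x - z), where
   s(x) = x exp(-1/x) for x > 0 and s = 0 otherwise is smooth, convex and
   1-Lipschitz.  Off B = {sgn x > z} this function vanishes, so both sides only
   see the normalised Laplace transform K(l) of s(sgn x - z) on B.  The entropy
   dominates the variance, which bounds K at one small l; Jensen's inequality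
   then gives ln K(l) <= 2 ln K(l/2) + H(c l), and iterating under the growth
   condition on H yields ln K(l) <= C (1 + l) + C H(c l).  Chernoff's bound
   compares the masses of {sgn x >= z + u} and B, that is, two values of U_mu.

   Conversely, the quantiles u_k = U_mu(k) satisfy mu(x > u_k) <= exp(-k)/2 <=
   mu(x >= u_k), so integrals of nondecreasing functions over (u_0, oo) compare
   with sums weighted by exp(-k).  With a = phi(u_0) one has Ent(exp phi) <=
   exp(a) E[Phi(phi - a)], Phi(t) = t exp t - exp t + 1.  For the positive part
   of phi - a, convexity gives f_k - f_j <= phi'(u_k) (u_k - u_j) for
   f_k = (phi(u_k) - a)^+, which the Fenchel-Young inequality turns into
   f_k - f_j <= H(C phi'(u_k)) + 1 + (k - j)/8; a discrete Hardy inequality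
   concludes.  The negative part of phi - a is bounded through the slope of phi
   at u_0 and is paid for on the side of u_0 where phi >= a.  The left tail is
   the right tail of the reflected measure. *)

(** * The cost and its Legendre transform *)

(** The measure is arbitrary: it may have atoms, and gaps where [U_map] jumps. A general smooth
    function could rise inside a gap at no cost in energy. A convex function that rises across a gap
    keeps at least that slope beyond it, which is why the inequality is restricted to convex
    functions and why increments of [phi] are always charged to the slope at the right end of the
    step (for the right tail). The shift [t0 ^+ 2] is what tolerates jumps:
    [inv_nonneg (legendre H) (t0 ^+ 2 + h)] stays above [t0 / 2] as [h] tends to 0, so errors of
    bounded size cost only a factor, and looking at the quantiles at integers loses nothing
    essential. In the other direction all constants must be uniform in the depth [z] of the tail.
    This is the purpose of conditioning on B: a bound on the plain Laplace transform would lose a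
    term of order [- ln mu(B)]. Since only [l] and [l / 2] are compared, no differentiation in [l]
    is needed; the exponent [alpha > 1] makes the costs collected by repeated halving summable. *)

Section ConvexFunctions.
Context {R : realType}.
Implicit Types f H : R -> R.

(** The chord from [x] to [x + e] bounds the increment from above. For the bound from below, [x] is
    the convex combination of [x + k * e] and [x - e] with weights [1 / (1 + k)] and
    [k / (1 + k)]. *)
Lemma convex_fun_local_lipschitz f x h : convex_fun f -> `|h| <= 1 ->
  `|f (x + h) - f x| <= `|h| * (`|f (x + 1) - f x| + `|f (x - 1) - f x|).
Proof.
move=> cf h1.
have key (e k : R) : `|e| = 1 -> 0 <= k -> k <= 1 ->
    `|f (x + k * e) - f x| <= k * (`|f (x + e) - f x| + `|f (x - e) - f x|).
  move=> e1 k0 k1.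
  have up := cf (x + e) x k k0 k1.
  rewrite (_ : k * (x + e) + (1 - k) * x = x + k * e) in up; last by ring.
  have k1_gt0 : 0 < 1 + k by lra.
  have ik0 : 0 <= (1 + k)^-1 by rewrite invr_ge0 ltW.
  have ik1 : (1 + k)^-1 <= 1 by rewrite invf_le1//; lra.
  have dn := cf (x + k * e) (x - e) (1 + k)^-1 ik0 ik1.
  rewrite (_ : _ * (x + k * e) + _ * (x - e) = x) in dn; last first.
    by field; apply/eqP; lra.
  have {}dn : (1 + k) * f x <= f (x + k * e) + k * f (x - e).
    rewrite -(ler_pM2l k1_gt0) in dn; apply: (le_trans dn).
    rewrite le_eqVlt; apply/orP; left; apply/eqP.
    by field; apply/eqP; lra.
  have a1 := ler_norm (f (x + e) - f x).
  have a2 := ler_norm (f (x - e) - f x).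
  have a3 := normr_ge0 (f (x + e) - f x).
  have a4 := normr_ge0 (f (x - e) - f x).
  rewrite ler_norml; apply/andP; split; nra.
have [h0|h0] := leP 0 h.
  have := key 1 h (normr1 _) h0; rewrite mulr1 (ger0_norm h0); apply.
  by rewrite -(ger0_norm h0).
have := key (-1) (- h); rewrite normrN normr1 mulrN mulr1 !opprK (ltr0_norm h0).
rewrite addrC [X in - h * X]addrC addrC; apply => //; first lra.
by rewrite -(ltr0_norm h0).
Qed.

Lemma convex_fun_continuous f : convex_fun f -> continuous f.
Proof.
move=> cf x; apply/cvgrPdist_lt => e e0.
set M := `|f (x + 1) - f x| + `|f (x - 1) - f x|.
have M0 : 0 <= M by rewrite addr_ge0.
have d0 : 0 < Num.min 1 (e / (M + 1)).
  by rewrite lt_min ltr01 /= divr_gt0 //; lra.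
near=> y.
have : `|y - x| < Num.min 1 (e / (M + 1)).
  by rewrite distrC; near: y; apply: (@cvgr_dist_lt _ _ _ (nbhs x)).
rewrite lt_min => /andP[y1 y2].
have := convex_fun_local_lipschitz x cf (ltW y1).
rewrite addrCA subrr addr0 -/M distrC => /le_lt_trans; apply.
rewrite ltr_pdivlMr in y2; last lra.
have := normr_ge0 (y - x); nra.
Unshelve. all: by end_near. Qed.

End ConvexFunctions.

Section Cost.
Context {R : realType} (H : R -> R) (t0 : R).
Hypothesis H_ge0 : forall x, 0 <= H x.
Hypothesis H_even : forall x, H (- x) = H x.
Hypothesis H_convex : convex_fun H.
Hypothesis t0_gt0 : 0 < t0.
Hypothesis H_near0 :
  forall x : R, - (2 * t0) <= x <= 2 * t0 -> H x = 4^-1 * x ^+ 2.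
Hypothesis legendre_superlinear :
  (fun x => legendre H x / x) x @[x --> +oo] --> +oo.

Lemma cost0 : H 0 = 0.
Proof.
have t0P := t0_gt0.
rewrite H_near0; first by rewrite expr2 !mulr0.
by apply/andP; split; lra.
Qed.

Lemma cost_norm (x : R) : H `|x| = H x.
Proof. by have [x0|x0] := ger0P x. Qed.

Lemma cost_mono (x y : R) : `|x| <= `|y| -> H x <= H y.
Proof.
suff key (u v : R) : 0 <= u -> u <= v -> H u <= H v.
  by move=> xy; rewrite -(cost_norm x) -(cost_norm y); apply: key.
move=> u0 uv; have [v0|vN0] := eqVneq v 0.
  by rewrite (_ : u = 0) ?cost0 //; lra.
have v_gt0 : 0 < v by rewrite lt_neqAle eq_sym vN0 (le_trans u0).
have := H_convex v 0 (t := u / v) (divr_ge0 u0 (ltW v_gt0)).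
rewrite ler_pdivrMr // mul1r => /(_ uv).
rewrite mulr0 addr0 cost0 mulr0 addr0 divfK // => /le_trans; apply.
by rewrite ler_piMl // ler_pdivrMr // mul1r.
Qed.

(** This moves a constant in front of [H] into its argument, hence into the constant [c] of the
    entropy inequality. *)
Lemma cost_mulr_ge (C x : R) : 1 <= C -> C * H x <= H (C * x).
Proof.
move=> C1; have C0 : 0 < C by lra.
have := H_convex (C * x) 0 (t := C^-1).
rewrite invr_ge0 (ltW C0) invf_le1 // => /(_ isT C1).
rewrite mulr0 addr0 cost0 mulr0 addr0 mulKf ?lt0r_neq0 // => h.
by rewrite mulrC -ler_pdivlMr // mulrC.
Qed.

(** [H] is quadratic up to [2 * t0], where its value is [t0 ^+ 2], and nondecreasing in [|x|]
    afterwards. *)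
Lemma cost_ge_min (x : R) : Num.min (4^-1 * x ^+ 2) (t0 ^+ 2) <= H x.
Proof.
have t0P := t0_gt0.
have [xt|xt] := leP `|x| (2 * t0).
  by rewrite H_near0 ?ge_min ?lexx // -ler_norml.
rewrite ge_min; apply/orP; right.
apply: (@le_trans _ _ (H (2 * t0))).
  rewrite H_near0; first by rewrite le_eqVlt; apply/orP; left; apply/eqP; field.
  by apply/andP; split; lra.
by apply: cost_mono; rewrite ger0_norm; lra.
Qed.

(** A real [sup] defaults to 0 when there is no supremum. At a large [z] this default would
    contradict [1 <= legendre H z / z], so the supremum is genuine there, and being finite at some
    [z >= |x|] it is finite at [x]. *)
Lemma legendre_has_sup (x : R) : has_sup [set x * y - H y | y in [set: R]].
Proof.
split; first by exists (x * 0 - H 0); exists 0.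
have [z [xz hz]] : exists z, `|x| <= z /\ 1 <= legendre H z / z.
  have /cvgryPge/(_ 1) e1 := legendre_superlinear.
  have [z zP] : exists z, (`|x| + 1 <= z) /\ 1 <= legendre H z / z.
    suff [z] : (\forall z \near +oo, (`|x| + 1 <= z) /\ 1 <= legendre H z / z).
      move=> [zr zP]; exists (z + 1); apply: zP; lra.
    near=> z; split; near: z => //.
    by apply: nbhs_pinfty_ge; rewrite num_real.
  by exists z; split; [lra|tauto].
have z0 : 0 <= z by apply: le_trans xz.
have [zz|] := pselect (has_sup [set z * y - H y | y in [set: R]]); last first.
  move=> /sup_out e; move: hz; rewrite /legendre e mul0r; lra.
have [_ [M Mz]] := zz; exists M => _ [y _ <-].
apply: (@le_trans _ _ (z * `|y| - H `|y|)); last by apply: Mz; exists `|y|.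
rewrite cost_norm lerD2r (le_trans (ler_norm _)) // normrM.
by rewrite ler_wpM2r.
Unshelve. all: by end_near. Qed.

Lemma fenchel_young (x y : R) : x * y <= H y + legendre H x.
Proof.
have : x * y - H y <= legendre H x; last by lra.
by apply: ub_le_sup; [case: (legendre_has_sup x)|exists y].
Qed.

Lemma legendre_le (x M : R) : (forall y, x * y - H y <= M) -> legendre H x <= M.
Proof.
move=> hM; apply: ge_sup; first by case: (legendre_has_sup x).
by move=> _ [y _ <-].
Qed.

Lemma legendre0 : legendre H 0 = 0.
Proof.
apply/eqP; rewrite eq_le; apply/andP; split.
  by apply: legendre_le => y; have := H_ge0 y; lra.
by have := fenchel_young 0 0; rewrite cost0; lra.
Qed.

Lemma legendre_ge0 x : 0 <= legendre H x.
Proof. by have := fenchel_young x 0; rewrite cost0; lra. Qed.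

Lemma legendre_convex : convex_fun (legendre H).
Proof.
move=> x y t t_ge0 t_le1; apply: legendre_le => z.
have := fenchel_young x z; have := fenchel_young y z; nra.
Qed.

Lemma legendre_scale (k x : R) : 0 <= k -> k <= 1 ->
  legendre H (k * x) <= k * legendre H x.
Proof.
move=> k0 k1; have := legendre_convex x 0 k0 k1.
by rewrite mulr0 addr0 legendre0 mulr0 addr0.
Qed.

(** [inv_nonneg] chooses a preimage and defaults to 0, so a preimage has to be exhibited. The
    intermediate value theorem applies on [[0, u + H 1]]: by Fenchel-Young at [y = 1] the transform
    is at least [u] at the right end. *)
Lemma legendre_inv (u : R) : 0 <= u ->
  0 <= inv_nonneg (legendre H) u /\ legendre H (inv_nonneg (legendre H) u) = u.
Proof.
move=> u0.
suff [t tP] : exists t, 0 <= t /\ legendre H t = u.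
  by rewrite /inv_nonneg; case: xgetP => [_ -> []//|/(_ t)].
have b0 : 0 <= u + H 1 by rewrite addr_ge0.
have /(IVT b0) : {within `[0, u + H 1], continuous (legendre H)}.
  apply: continuous_subspaceT => x.
  by apply: convex_fun_continuous; exact: legendre_convex.
move=> /(_ u) [].
  rewrite legendre0.
  have e1 := fenchel_young (u + H 1) 1; have e2 := legendre_ge0 (u + H 1).
  by rewrite ge_min le_max u0 /=; apply/orP; right; lra.
by move=> t; rewrite in_itv/= => /andP[t_ge0 _] tu; exists t.
Qed.

(** If the chosen preimage [s] were below [t], convexity and the value 0 at 0 would give [u <= (s /
    t) * legendre H t <= (s / t) * u < u]. *)
Lemma le_legendre_inv (u t : R) : 0 < u -> legendre H t <= u ->
  t <= inv_nonneg (legendre H) u.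
Proof.
move=> u0 tu; have [s0 su] := legendre_inv (ltW u0).
set s := inv_nonneg _ _ in s0 su *; rewrite leNgt; apply/negP => st.
have t_gt0 : 0 < t by lra.
have := @legendre_scale (s / t) t.
rewrite divfK ?lt0r_neq0 // su divr_ge0 ?(ltW t_gt0) // ler_pdivrMr // mul1r.
move=> /(_ isT (ltW st)); rewrite leNgt => /negP; apply.
rewrite mulrAC ltr_pdivrMr //; nra.
Qed.

(** The transform at [t0 / 2] is at most [t0 ^+ 2]: below [2 * t0] this is a quadratic estimate, and
    beyond it [H y >= (t0 / 2) * |y|] by convexity. This uniform lower bound absorbs additive
    constants later. *)
Lemma legendre_inv_ge (h : R) : 0 <= h ->
  t0 / 2 <= inv_nonneg (legendre H) (t0 ^+ 2 + h).
Proof.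
have t0P := t0_gt0.
move=> h0; have t02 : 0 < t0 ^+ 2 by rewrite exprn_gt0.
apply: le_legendre_inv; first lra.
apply: legendre_le => y.
have [yt|yt] := leP `|y| (2 * t0).
  rewrite H_near0 -?ler_norml //; nra.
have y0 : 0 < `|y| by lra.
have : `|y| / (2 * t0) * H (2 * t0) <= H (`|y| / (2 * t0) * (2 * t0)).
  by apply: cost_mulr_ge; rewrite ler_pdivlMr; lra.
rewrite H_near0; last by apply/andP; split; lra.
rewrite divfK ?cost_norm ?lt0r_neq0 //; last lra.
rewrite (_ : _ / _ * _ = t0 / 2 * `|y|); last by field; apply/eqP; lra.
have := ler_norm y; nra.
Qed.

(** Fenchel-Young is applied to [k * s] and [p / (b * k)]. A small [k] makes the term linear in [n]
    as small as desired, at the price of a larger argument of [H]. *)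
Lemma cost_young_inv (b k p n : R) : 0 < b -> 0 < k -> k <= 1 -> 0 <= n ->
  p * (b^-1 * inv_nonneg (legendre H) (t0 ^+ 2 + n)) <=
  H (p / (b * k)) + k * (t0 ^+ 2 + n).
Proof.
move=> b0 k0 k1 n0.
have tn : 0 <= t0 ^+ 2 + n by rewrite addr_ge0 // exprn_ge0 // ltW.
have [s0 su] := legendre_inv tn.
set s := inv_nonneg _ _ in s0 su *.
have := fenchel_young (k * s) (p / (b * k)).
have := legendre_scale s (ltW k0) k1; rewrite su.
rewrite (_ : k * s * (p / (b * k)) = p * (b^-1 * s)); first by lra.
by field; rewrite !lt0r_neq0.
Qed.

End Cost.

(** * Quantiles *)

Section Quantile.
Context {R : realType} (mu : probability R R).

(** The identity as a random variable: [distF mu] becomes its [cdf], with known limits and right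
    continuity. *)
Let idTR : R -> R := idfun.
#[local] HB.instance Definition _ :=
  @isMeasurableFun.Build _ _ _ _ idTR (@measurable_id _ _ setT).
Let X : {RV mu >-> R} := idTR.

Lemma probability_fin (A : set R) : measurable A -> mu A = (fine (mu A))%:E.
Proof. by move=> mA; rewrite fineK // fin_num_measure. Qed.

Let cdfE : cdf X = EFin \o distF mu.
Proof.
apply/funext => r; rewrite /cdf /distribution /pushforward preimage_id.
by rewrite probability_fin.
Qed.

Let distF_mono x y : x <= y -> distF mu x <= distF mu y.
Proof.
move=> xy; have := @cdf_nondecreasing _ _ _ mu X _ _ xy.
by rewrite cdfE /= lee_fin.
Qed.

Let quantile_has_inf (t : R) : 0 < t < 1 -> has_inf [set y | t <= distF mu y].
Proof.
move=> /andP[t0 t1]; split.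
  have /fine_cvg := @cvg_cdfy1 _ _ _ mu X; rewrite cdfE.
  move=> /cvgr_gt/(_ _ t1)/filter_ex[y]/= ty.
  by exists y => /=; exact: ltW.
have /fine_cvg := @cvg_cdfNy0 _ _ _ mu X; rewrite cdfE.
move=> /cvgr_lt/(_ _ t0)/filter_ex[m]/= mt; exists m => y /= ty.
rewrite leNgt; apply/negP => /ltW/distF_mono ym.
by have := le_lt_trans (le_trans ty ym) mt; rewrite ltxx.
Qed.

(** By right continuity the closed half-line carries at least [t]; the next lemma shows that the
    open one carries at most [t]. An atom at the quantile can make both strict, which is why tails
    are always bounded above on open half-lines and below on closed ones. *)
Lemma le_mu_quantile (t : R) : 0 < t < 1 ->
  (t%:E <= mu `]-oo, quantile mu t]%classic)%E.
Proof.
move=> t01; have [ne hb] := quantile_has_inf t01.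
rewrite probability_fin // -/(distF mu _) lee_fin.
have := @cdf_right_continuous _ _ _ mu X (quantile mu t).
rewrite cdfE /= => /fine_cvg/cvgr_to_ge; apply.
near=> r.
have /inf_lt : inf [set y | t <= distF mu y] < r by near: r; exact: nbhs_right_gt.
by move=> /(_ ne)[y /= ty yr]; rewrite (le_trans ty) // distF_mono // ltW.
Unshelve. all: by end_near. Qed.

Lemma mu_quantile_le (t : R) : 0 < t < 1 ->
  (mu `]-oo, quantile mu t[%classic <= t%:E)%E.
Proof.
move=> t01; have [ne hb] := quantile_has_inf t01.
set q := quantile mu t.
pose F (n : nat) : set R := `]-oo, q - n.+1%:R^-1]%classic.
have FE : `]-oo, q[%classic = \bigcup_n F n.
  apply/seteqP; split=> [x /=|x [n _]]; rewrite /F /= !in_itv /=; last first.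
    by move=> /le_lt_trans; apply; rewrite ltrBlDr ltrDl.
  move=> xq; have [n nx] := @ltr_add_invr R _ _ xq.
  by exists n => //=; rewrite in_itv /= lerBrDr ltW.
rewrite FE.
have : (mu \o F) x @[x --> \oo] --> mu (\bigcup_n F n).
  apply: nondecreasing_cvg_mu => [i|| m n mn].
  - exact: measurable_itv.
  - by apply: bigcup_measurable => i _; exact: measurable_itv.
  - apply/subsetPset; apply: subset_itvl.
    by rewrite bnd_simp lerD2l lerN2 lef_pV2 ?posrE // ler_nat.
move=> /cvge_to_le; apply; near=> n => /=.
rewrite probability_fin -?/(distF mu _) ?lee_fin; last exact: measurable_itv.
rewrite leNgt; apply/negP => /ltW tF.
have /(ge_inf hb) : [set y | t <= distF mu y] (q - n.+1%:R^-1) by [].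
by rewrite -/(quantile mu t) -/q lerBrDr gerDl leNgt invr_gt0 ltr0n.
Unshelve. all: by end_near. Qed.

Let F_tau01 (x : R) : 0 < F_tau x < 1.
Proof.
have e0 := expR_gt0 (- `|x|).
have e1 : expR (- `|x|) <= 1 by rewrite -expR0 ler_expR oppr_le0.
by rewrite /F_tau; case: ifP => _; apply/andP; split; lra.
Qed.

Lemma U_map_tail (x : R) : 0 <= x ->
  (mu [set y | (U_map mu x < y)%R] <= (expR (- x) / 2)%:E)%E /\
  ((expR (- x) / 2)%:E <= mu [set y | (U_map mu x <= y)%R])%E.
Proof.
move=> x0.
have Fx : F_tau x = 1 - expR (- x) / 2.
  by rewrite /F_tau ltNge x0 /= ger0_norm // mulrC.
have := le_mu_quantile (F_tau01 x); have := mu_quantile_le (F_tau01 x).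
rewrite -/(U_map mu x) Fx => h1 h2; split.
  rewrite (_ : [set y | _] = ~` `]-oo, U_map mu x]%classic); last first.
    by apply/seteqP; split=> y /=; rewrite in_itv /= ltNge => /negP.
  rewrite probability_setC //; move: h2; rewrite probability_fin //.
  by rewrite -EFinB !lee_fin; lra.
rewrite (_ : [set y | _] = ~` `]-oo, U_map mu x[%classic); last first.
  by apply/seteqP; split=> y /=; rewrite in_itv /= leNgt => /negP.
rewrite probability_setC //; move: h1; rewrite probability_fin //.
by rewrite -EFinB !lee_fin; lra.
Qed.

Lemma U_map_tail_opp (x : R) : 0 <= x ->
  (mu [set y | (- U_map mu (- x) < - y)%R] <= (expR (- x) / 2)%:E)%E /\
  ((expR (- x) / 2)%:E <= mu [set y | (- U_map mu (- x) <= - y)%R])%E.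
Proof.
move=> x0.
have Fx : F_tau (- x) = expR (- x) / 2.
  rewrite /F_tau normrN ger0_norm //; case: ifPn => [_|]; first by rewrite mulrC.
  (* [F_tau] changes formula at 0, where both formulas give 1/2. *)
  rewrite oppr_lt0 -leNgt => x0'; have -> : x = 0 by lra.
  by rewrite oppr0 expR0; field.
have := le_mu_quantile (F_tau01 (- x)); have := mu_quantile_le (F_tau01 (- x)).
rewrite -/(U_map mu (- x)) Fx => h1 h2; split.
  rewrite (_ : [set y | _] = `]-oo, U_map mu (- x)[%classic) //.
  by apply/seteqP; split=> y /=; rewrite in_itv /= ltrN2.
rewrite (_ : [set y | _] = `]-oo, U_map mu (- x)]%classic) //.
by apply/seteqP; split=> y /=; rewrite in_itv /= lerN2.
Qed.

End Quantile.

(* Both tails of [mu] are treated at once through a coordinate [Y], which is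
   the identity for the right tail and the opposite for the left tail. *)
Definition exp_quantiles {R : realType} (mu : probability R R)
    (Y u : R -> R) :=
  forall x, 0 <= x ->
    (mu [set y | (u x < Y y)%R] <= (expR (- x) / 2)%:E)%E /\
    ((expR (- x) / 2)%:E <= mu [set y | (u x <= Y y)%R])%E.

(** * Weighted sums *)

Section EntropyFunction.
Context {R : realType}.
Implicit Types t : R.

(** This is [s * ln s - s + 1] at [s = expR t], the gap between [s * ln s] and its tangent at 1. *)
Definition entropy_fun t := t * expR t - expR t + 1.

Lemma entropy_fun0 : entropy_fun 0 = 0.
Proof. by rewrite /entropy_fun expR0; ring. Qed.

Lemma entropy_fun_le_sqr t : entropy_fun t <= t * (expR t - 1).
Proof. by rewrite /entropy_fun; have := expR_ge1Dx t; lra. Qed.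

Lemma entropy_fun_ge0 t : 0 <= entropy_fun t.
Proof.
have := expR_ge1Dx (- t); have e0 := expR_gt0 t; rewrite expRN => h.
have : expR t * (1 - t) <= 1.
  by rewrite -[leRHS](divff (lt0r_neq0 e0)) ler_wpM2l // ltW.
by rewrite /entropy_fun; lra.
Qed.

Lemma expR_sub1_le t : expR t - 1 <= t * expR t.
Proof. by have := entropy_fun_ge0 t; rewrite /entropy_fun; lra. Qed.

(** The tangent inequalities of [expR] at [t] and at [u] suffice: the second is weighted by [1 - t]
    when [t <= 1], the first by [u - 1] otherwise. *)
Lemma entropy_fun_mono t u : 0 <= t -> t <= u -> entropy_fun t <= entropy_fun u.
Proof.
move=> t_ge0 tu; have eu := expR_gt0 u; have et := expR_gt0 t.
have tangent (a b : R) : expR a * (1 + (b - a)) <= expR b.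
  have := expR_ge1Dx (b - a); rewrite expRD expRN -(ler_pM2l (expR_gt0 a)).
  by rewrite mulrCA divff ?mulr1 // lt0r_neq0 // expR_gt0.
have h1 := tangent t u; have h2 := tangent u t; rewrite /entropy_fun.
have [t1|t1] := leP t 1.
  have : (1 - t) * (expR u * (1 + (t - u))) <= (1 - t) * expR t.
    by rewrite ler_wpM2l //; lra.
  have : 0 <= expR u * ((u - t) * t) by rewrite !mulr_ge0 ?expR_ge0 //; lra.
  by lra.
have : (u - 1) * (expR t * (1 + (u - t))) <= (u - 1) * expR u.
  by rewrite ler_wpM2l //; lra.
have : 0 <= expR t * ((u - t) * u) by rewrite !mulr_ge0 ?expR_ge0 //; lra.
by lra.
Qed.

End EntropyFunction.

Section WeightedSums.
Context {R : realType}.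
Implicit Types x y f h d : nat -> R.

Local Notation w k := (expR (- k%:R : R)).

Lemma weightS k : w k.+1 = w k * expR (-1).
Proof. by rewrite -expRD -opprD -natr1. Qed.

(** Summing the recursion against the weights gives [S <= 2/3 * S + S'] for the two sums, and
    [3 = 1 / (1 - 2/3)]. *)
Lemma weighted_sum_recursion x y (rho : R) N : (forall k, 0 <= x k) ->
  (forall k, 0 <= y k) -> rho * expR (-1) <= 2 / 3 -> x 0 <= y 0 ->
  (forall k, x k.+1 <= rho * x k + y k.+1) ->
  \sum_(k < N) x k * w k <= 3 * \sum_(k < N) y k * w k.
Proof.
move=> x0 y0 hrho xy0 rec.
have wp k : 0 < w k by exact: expR_gt0.
have step n : \sum_(k < n.+1) x k * w k <=
    2 / 3 * (\sum_(k < n) x k * w k) + \sum_(k < n.+1) y k * w k.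
  rewrite big_ord_recl [X in _ <= _ + X]big_ord_recl /= addrCA.
  apply: lerD; first by rewrite ler_wpM2r // ltW.
  rewrite mulr_sumr -big_split /=; apply: ler_sum => k _.
  rewrite /bump /= add1n weightS.
  apply: (@le_trans _ _ ((rho * x k + y k.+1) * (w k * expR (-1)))).
    by rewrite ler_wpM2r // mulr_ge0 // expR_ge0.
  rewrite mulrDl lerD2r.
  rewrite (_ : rho * x k * _ = (rho * expR (-1)) * (x k * w k)); last by ring.
  by rewrite ler_wpM2r // mulr_ge0 // ltW.
elim: N => [|n IH]; first by rewrite !big_ord0 mulr0.
have := step n.
have : \sum_(k < n) y k * w k <= \sum_(k < n.+1) y k * w k.
  by rewrite big_ord_recr /= lerDl mulr_ge0 // ltW.
lra.
Qed.

(* A discrete Hardy inequality for the truncation of [f] at level 1 bounds the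
   sum up to, and the geometric weight at, the first passage of [f] above 1;
   beyond it, either [f k <= 2 * h k] or [f] grows at rate at most 1/4, too
   slowly to compete with the weights. *)
Lemma weighted_entropy_le f d h (C : R) N : f 0 = 0 ->
  (forall k, f k <= f k.+1) -> (forall k, 0 <= h k) ->
  (forall k, 0 <= d k) ->
  (forall k, f k.+1 - f k <= d k.+1) ->
  (forall k, Num.min (d k) 1 ^+ 2 <= C * h k) ->
  (forall j k, (j < k)%N -> f k - f j <= h k + 1 + (k%:R - j%:R) / 8) ->
  \sum_(k < N) entropy_fun (f k) * w k <=
  (2 + 12 * C * (expR 1 + 3 * expR 9)) * \sum_(k < N) h k * expR (f k) * w k.
Proof.
move=> f0 fS h0 d0 fd dh fh.
have wp k : 0 < w k by exact: expR_gt0.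
have fge0 k : 0 <= f k by elim: k => [|k IH]; rewrite ?f0 // (le_trans IH).
pose g k := Num.min (f k) 1.
have g0 k : 0 <= g k by rewrite le_min fge0 ler01.
pose dl k := Num.min (d k) 1.
have dl0 k : 0 <= dl k by rewrite le_min d0 ler01.
have e1 : expR (-1) <= 2^-1 :> R.
  rewrite expRN lef_pV2 ?posrE ?expR_gt0 //.
  by have := expR_ge1Dx (1 : R); lra.
(* Here [(a + b)^2 <= 4/3 * a^2 + 4 * b^2], which is [(a - 3 * b)^2 >= 0]; the factor 4/3 meets the
   rate 2/3 of the recursion because [expR (-1) <= 1/2]. *)
have sum_g : \sum_(k < N) g k ^+ 2 * w k <=
    3 * \sum_(k < N) (4 * dl k ^+ 2) * w k.
  apply: (@weighted_sum_recursion (fun k => g k ^+ 2)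
    (fun k => 4 * dl k ^+ 2) (4 / 3)) => /=.
  - by move=> k; exact: sqr_ge0.
  - by move=> k; rewrite mulr_ge0 // sqr_ge0.
  - by lra.
  - by rewrite /g f0 minEle ler01 expr0n mulr_ge0 // sqr_ge0.
  - move=> k.
    have gd : g k.+1 <= g k + dl k.+1.
      have := fd k; have := g0 k; have := dl0 k.+1.
      rewrite /g /dl; case: (leP (f k.+1)); case: (leP (f k));
        case: (leP (d k.+1)); lra.
    have gk := g0 k; have gk1 := g0 k.+1; have dk := dl0 k.+1.
    apply: (@le_trans _ _ ((g k + dl k.+1) ^+ 2)).
      by rewrite ler_sqr ?nnegrE // addr_ge0.
    have := sqr_ge0 (g k - 3 * dl k.+1); nra.
(* The term of index [j] dominates [expR (2 * f k)], up to a constant, when [f] passes 1 at [j] and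
   then grows at rate at most 1/4. The growth [expR (1/2)] per step is still beaten by the weights,
   as [expR (1/2) >= 3/2]. *)
pose B k := \sum_(j < k.+1) expR ((k%:R - j%:R) / 2) * g j ^+ 2.
have sum_B : \sum_(k < N) B k * w k <= 3 * \sum_(k < N) g k ^+ 2 * w k.
  apply: (@weighted_sum_recursion B (fun k => g k ^+ 2) (expR (2^-1))) => /=.
  - by move=> k; apply: sumr_ge0 => j _; rewrite mulr_ge0 ?expR_ge0 ?sqr_ge0.
  - by move=> k; exact: sqr_ge0.
  - rewrite -expRD (_ : 2^-1 + -1 = - (2^-1)); last by lra.
    have := expR_ge1Dx (2^-1 : R); rewrite expRN => e2.
    by rewrite -[leRHS]invf_div lef_pV2 ?posrE ?expR_gt0 //; lra.
  - by rewrite /B big_ord1 /= subrr mul0r expR0 mul1r.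
  - move=> k; rewrite /B big_ord_recr /= subrr mul0r expR0 mul1r lerD2r.
    rewrite mulr_sumr le_eqVlt; apply/orP; left; apply/eqP.
    apply: eq_bigr => j _; rewrite mulrA -expRD; congr (expR _ * _).
    by rewrite -natr1; field.
have pointwise k : entropy_fun (f k) <=
    expR 1 * g k ^+ 2 + 2 * (h k * expR (f k)) + expR 9 * B k.
  have B0 : 0 <= B k.
    by apply: sumr_ge0 => j _; rewrite mulr_ge0 ?expR_ge0 ?sqr_ge0.
  have eB : 0 <= expR 9 * B k by rewrite mulr_ge0 ?expR_ge0.
  have fk0 := fge0 k; have ef := expR_gt0 (f k).
  have eh : 0 <= h k * expR (f k) by rewrite mulr_ge0 ?expR_ge0.
  have eg : 0 <= expR 1 * g k ^+ 2 by rewrite mulr_ge0 ?expR_ge0 ?sqr_ge0.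
  have [fk1|fk1] := leP (f k) 1.
    have : entropy_fun (f k) <= expR 1 * g k ^+ 2; last by lra.
    apply: (le_trans (entropy_fun_le_sqr _)).
    rewrite /g min_l //; apply: (@le_trans _ _ (f k * (f k * expR (f k)))).
      by rewrite ler_wpM2l // expR_sub1_le.
    rewrite mulrA -expr2 mulrC ler_wpM2r ?sqr_ge0 //.
    by rewrite ler_expR.
  have : entropy_fun (f k) <= f k * expR (f k).
    by rewrite /entropy_fun; have := expR_ge1Dx (f k); lra.
  have [hk|hk] := leP (f k) (2 * h k).
    have : f k * expR (f k) <= 2 * h k * expR (f k) by rewrite ler_wpM2r // ltW.
    by lra.
  suff : f k * expR (f k) <= expR 9 * B k by lra.
  (* The first passage above 1 is at some [n.+1], since [f 0 = 0]; there [g] equals 1, so that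
     single term of [B k] is enough. *)
  have ex : exists n, f n > 1 by exists k.
  case: (ex_minnP ex) => -[|n]; first by rewrite f0 ltr10.
  move=> fn1 nmin.
  have fn : f n <= 1.
    by rewrite leNgt; apply/negP => /nmin; rewrite ltnn.
  have nk : (n < k)%N by exact: nmin.
  have fk_le := fh _ _ nk.
  have nk' : n.+1%:R <= k%:R :> R by rewrite ler_nat.
  rewrite -natr1 in nk'.
  (* From [f n <= 1] and [2 * h k < f k], the increment bound gives [f k <= 4 + (k - n) / 4]. It is
     doubled because [f * expR f <= expR (2 * f)], and 9 rounds up 8 + 1/2. *)
  have kn : f k + f k <= 9 + (k%:R - n.+1%:R) / 2 by rewrite -natr1; lra.
  apply: (@le_trans _ _ (expR (9 + (k%:R - n.+1%:R) / 2))).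
    apply: (@le_trans _ _ (expR (f k + f k))); last by rewrite ler_expR.
    rewrite expRD ler_wpM2r ?expR_ge0 //.
    by have := expR_ge1Dx (f k); lra.
  rewrite expRD ler_wpM2l ?expR_ge0 // /B.
  have nk2 : (n.+1 < k.+1)%N by [].
  rewrite (bigD1 (Ordinal nk2)) //= /g min_r ?(ltW fn1) // expr1n mulr1.
  by rewrite lerDl sumr_ge0 // => j _; rewrite mulr_ge0 ?expR_ge0 ?sqr_ge0.
have sum_d : \sum_(k < N) (4 * dl k ^+ 2) * w k <=
    4 * C * \sum_(k < N) h k * expR (f k) * w k.
  rewrite mulr_sumr; apply: ler_sum => k _.
  rewrite mulrA ler_wpM2r ?(ltW (wp _)) // -!mulrA ler_wpM2l //.
  apply: (le_trans (dh k)); have := dh k; have := sqr_ge0 (Num.min (d k) 1).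
  have := expR_ge1Dx (f k); have := fge0 k; nra.
(* The sum of [g ^ 2] costs [3 * 4 * C] and the sum of [B] three times as much, which yields the
   stated constant. *)
have : \sum_(k < N) entropy_fun (f k) * w k <=
    expR 1 * \sum_(k < N) g k ^+ 2 * w k +
    2 * \sum_(k < N) h k * expR (f k) * w k + expR 9 * \sum_(k < N) B k * w k.
  rewrite !mulr_sumr -!big_split /=; apply: ler_sum => k _.
  apply: (le_trans (ler_wpM2r (ltW (wp k)) (pointwise k))).
  by rewrite le_eqVlt; apply/orP; left; apply/eqP; ring.
have := expR_gt0 (1 : R); have := expR_gt0 (9 : R).
move: sum_g sum_B sum_d; nra.
Qed.

End WeightedSums.

(** * Integrals against weighted sums *)

Lemma measurable_superlevel {R : realType} (Y : R -> R) (a : R) :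
  measurable_fun setT Y -> measurable [set x | a < Y x].
Proof.
move=> mY; have : measurable (setT `&` Y @^-1` `]a, +oo[%classic).
  by apply: mY => //; exact: measurable_itv.
rewrite setTI (_ : Y @^-1` _ = [set x | a < Y x]) //.
by apply/seteqP; split=> x /=; rewrite in_itv /= andbT.
Qed.

Lemma measurable_superlevel_ge {R : realType} (Y : R -> R) (a : R) :
  measurable_fun setT Y -> measurable [set x | a <= Y x].
Proof.
move=> mY; have : measurable (setT `&` Y @^-1` `[a, +oo[%classic).
  by apply: mY => //; exact: measurable_itv.
rewrite setTI (_ : Y @^-1` _ = [set x | a <= Y x]) //.
by apply/seteqP; split=> x /=; rewrite in_itv /= andbT.
Qed.

Section ExponentialQuantiles.
Context {R : realType} (mu : probability R R) (Y u : R -> R).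
Hypothesis mY : measurable_fun setT Y.
Hypothesis uQ : exp_quantiles mu Y u.

Local Notation w k := (expR (- k%:R : R)).

Let measurable_gt a : measurable [set x | a < Y x].
Proof. exact: measurable_superlevel. Qed.

Let measurable_ge a : measurable [set x | a <= Y x].
Proof. exact: measurable_superlevel_ge. Qed.

Lemma exp_quantiles_le x y : 0 <= x -> x < y -> u x <= u y.
Proof.
move=> x0 xy; have [_ h1] := uQ x0; have [h2 _] := uQ (le_trans x0 (ltW xy)).
rewrite leNgt; apply/negP => uxy.
have : (mu [set z | (u x <= Y z)%R] <= mu [set z | (u y < Y z)%R])%E.
  apply: le_measure; rewrite ?inE //.
  by move=> z /=; exact: lt_le_trans.
move=> /(le_trans h1)/le_trans/(_ h2); rewrite lee_fin.
have : expR (- y) < expR (- x) by rewrite ltr_expR ltrN2.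
by lra.
Qed.

Let us k : u k%:R <= u k.+1%:R.
Proof. by apply: exp_quantiles_le => //; rewrite ltr_nat. Qed.

Let u_le j k : (j <= k)%N -> u j%:R <= u k%:R.
Proof.
rewrite leq_eqVlt => /orP[/eqP -> //|jk].
by apply: exp_quantiles_le => //; rewrite ltr_nat.
Qed.

Variable G : R -> R.
Hypothesis G_ge0 : forall x, 0 <= G x.
Hypothesis G_mono : forall x y, u 0 <= x -> x <= y -> G x <= G y.
Hypothesis mG : measurable_fun setT (G \o Y).

Let mGE (D : set R) : measurable_fun D (EFin \o (G \o Y)).
Proof. by apply: measurable_funTS; apply/measurable_EFinP. Qed.

(** On the layer [u N < Y <= u N.+1] the integrand is at most [G (u N.+1)] and the mass at most
    [w N / 2]. Matching the indices costs a factor [expR 1]. *)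
Lemma integral_le_weighted_sum (C : R) :
  (forall N, \sum_(k < N) G (u k.+1%:R) * w k.+1 <= C) ->
  (\int[mu]_(x in [set x | (u 0 < Y x)%R]) (G (Y x))%:E <= (expR 1 / 2 * C)%:E)%E.
Proof.
move=> sumC.
pose F (N : nat) := [set x | u 0 < Y x] `\` [set x | u N%:R < Y x].
have mF N : measurable (F N) by apply: measurableD.
have intF N : (\int[mu]_(x in F N) (G (Y x))%:E <=
    (expR 1 / 2 * \sum_(k < N) G (u k.+1%:R) * w k.+1)%:E)%E.
  elim: N => [|N IH].
    rewrite big_ord0 mulr0 (_ : F 0%N = set0) ?integral_set0 //.
    by rewrite /F setDv.
  pose D := [set x | u N%:R < Y x] `\` [set x | u N.+1%:R < Y x].
  have mD : measurable D by apply: measurableD.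
  have -> : F N.+1 = F N `|` D.
    apply/seteqP; split=> x; rewrite /F /D /=.
      move=> [x0 xN]; by have [xN'|xN'] := ltP (u N%:R) (Y x); [right|left].
    move=> [[x0 xN]|[x0 xN]]; split => //.
      by move=> x1; apply: xN; exact: le_lt_trans (us N) x1.
    by apply: le_lt_trans x0; exact: (u_le (leq0n N)).
  rewrite ge0_integral_setU //; last 2 first.
    by move=> x _; rewrite lee_fin.
    by rewrite disj_set2E; apply/eqP/seteqP; split => // x [[_ ?] [? _]].
  rewrite big_ord_recr /= mulrDr EFinD; apply: leeD => //.
  apply: (@le_trans _ _ (\int[mu]_(x in D) (cst (G (u N.+1%:R))%:E x))%E).
    apply: ge0_le_integral => //.
    - by move=> x _; rewrite lee_fin.
    - move=> x [/= x0 /negP]; rewrite -leNgt => x1; rewrite lee_fin.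
      apply: G_mono => //; apply: le_trans (ltW x0); exact: (u_le (leq0n N)).
  rewrite integral_cst //.
  apply: (@le_trans _ _ ((G (u N.+1%:R))%:E * (w N / 2)%:E)%E).
    rewrite lee_wpmul2l ?lee_fin //.
    have [h _] := uQ (ler0n R N); apply: le_trans h.
    by apply: le_measure; rewrite ?inE // => x [].
  rewrite -EFinM lee_fin le_eqVlt; apply/orP; left; apply/eqP.
  rewrite weightS (expRN 1); field; exact: lt0r_neq0 (expR_gt0 _).
have cvgF : (\int[mu]_(x in F i) (G (Y x))%:E)%E @[i --> \oo] -->
    (\int[mu]_(x in \bigcup_i F i) (G (Y x))%:E)%E.
  apply: ge0_nondecreasing_set_cvg_integral => //.
  - move=> m n mn; apply/subsetPset => x [x0 xm]; split => //= xn.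
    by apply: xm => /=; apply: le_lt_trans (u_le mn) xn.
  - by move=> i x _; rewrite lee_fin.
have mU : measurable (\bigcup_i F i) by exact: bigcup_measurable.
(* The [u k] may stay bounded, so the layers need not cover the half-line; what remains has mass at
   most [w n / 2] for every [n]. *)
pose N := [set x | u 0 < Y x] `\` \bigcup_i F i.
have mN : measurable N by apply: measurableD.
have muN : mu N = 0%E.
  apply/eqP; rewrite eq_le measure_ge0 andbT.
  apply/lee_addgt0Pr => /= e e0; rewrite add0e.
  have [n ne] : exists n : nat, w n / 2 <= e.
    exists (Num.truncn e^-1).+1; move: (truncnS_gt e^-1).
    move: (_.+1) => n en; have e1 := expR_ge1Dx (n%:R : R).
    have n0 := expR_gt0 (n%:R : R).
    have : (expR (n%:R : R))^-1 <= e.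
      by rewrite invf_ple ?posrE //; lra.
    by move: n0; rewrite -invr_gt0 expRN; lra.
  have [h _] := uQ (ler0n R n).
  apply: (@le_trans _ _ (mu [set x | u n%:R < Y x])).
    apply: le_measure; rewrite ?inE // => x [/= x0 xF].
    by apply: contrapT => xn; apply: xF; exists n.
  by rewrite (le_trans h) // lee_fin.
rewrite (_ : [set x | u 0 < Y x] = \bigcup_i F i `|` N); last first.
  by rewrite /N setDUK // => x [i _ []].
rewrite ge0_integral_setU //; last 2 first.
  by move=> x _; rewrite lee_fin.
  by rewrite disj_set2E; apply/eqP/seteqP; split => // x [? [_ ]].
rewrite [X in (_ + X)%E](null_set_integral mN) ?adde0 //.
apply: (cvge_to_le cvgF); apply: nearW => i; apply: (le_trans (intF i)).
by rewrite lee_fin ler_wpM2l // divr_ge0 // expR_ge0.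
Qed.

(** Lower bounds on tails give none on single layers, so this is a summation by parts: the induction
    carries the surplus [P m - w m / 2], and pushing it to the next level is favourable because [G]
    is nondecreasing. The factor 1/4 comes from [(w k - w k.+1) / 2 >= w k / 4]. *)
Lemma weighted_sum_le_integral N :
  ((4^-1 * \sum_(k < N) G (u k%:R) * w k)%:E <=
   \int[mu]_(x in [set x | (u 0 <= Y x)%R]) (G (Y x))%:E)%E.
Proof.
pose P m := fine (mu [set x | u m%:R <= Y x]).
have PE m : mu [set x | u m%:R <= Y x] = (P m)%:E by rewrite probability_fin.
have wP m : w m / 2 <= P m.
  by have [_] := uQ (ler0n R m); rewrite PE lee_fin.
have G_ge m x : u m%:R <= Y x -> G (u m%:R) <= G (Y x).
  by apply: G_mono; exact: (u_le (leq0n m)).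
have key n : forall m, ((G (u m%:R) * (P m - w m / 2) +
    \sum_(k < n) G (u (m + k)%:R) * ((w (m + k) - w (m + k).+1) / 2))%:E <=
    \int[mu]_(x in [set x | (u m%:R <= Y x)%R]) (G (Y x))%:E)%E.
  elim: n => [|n IH] m.
    rewrite big_ord0 addr0.
    apply: (@le_trans _ _
      (\int[mu]_(x in [set x | (u m%:R <= Y x)%R]) (cst (G (u m%:R))%:E x))%E).
      rewrite integral_cst // [X in (_ * X)%E](PE m) -EFinM lee_fin ler_wpM2l //.
      by have := expR_gt0 (- m%:R : R); lra.
    apply: ge0_le_integral => //.
    - by move=> x _; rewrite lee_fin.
    - by move=> x /=; rewrite lee_fin; exact: G_ge.
  pose D := [set x | u m%:R <= Y x] `\` [set x | u m.+1%:R <= Y x].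
  have mD : measurable D by apply: measurableD.
  have DU : [set x | u m%:R <= Y x] = D `|` [set x | u m.+1%:R <= Y x].
    rewrite /D setUC setDUK // => x /=; exact: le_trans (us m).
  have muD : mu D = (P m - P m.+1)%:E.
    rewrite measureD //; last by rewrite [X in (X < _)%E](PE m) ltry.
    rewrite setIidr; first by rewrite EFinB; congr (_ - _)%E; exact: PE.
    by move=> x /=; exact: le_trans (us m).
  have -> : (\int[mu]_(x in [set x | (u m%:R <= Y x)%R]) (G (Y x))%:E)%E =
     (\int[mu]_(x in D) (G (Y x))%:E +
      \int[mu]_(x in [set x | (u m.+1%:R <= Y x)%R]) (G (Y x))%:E)%E.
    rewrite DU ge0_integral_setU //.
      by move=> x _; rewrite lee_fin.
    by rewrite disj_set2E; apply/eqP/seteqP; split => // x [[_ ?] ?].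
  apply: (@le_trans _ _ ((G (u m%:R) * (P m - P m.+1))%:E +
    (G (u m.+1%:R) * (P m.+1 - w m.+1 / 2) +
    \sum_(k < n) G (u (m.+1 + k)%:R) * ((w (m.+1 + k) - w (m.+1 + k).+1) / 2))%:E)%E).
    rewrite -EFinD lee_fin big_ord_recl /= addn0.
    under eq_bigr do rewrite /bump /= add1n -addSnnS.
    have : G (u m%:R) * (P m.+1 - w m.+1 / 2) <=
           G (u m.+1%:R) * (P m.+1 - w m.+1 / 2).
      rewrite ler_wpM2r ?subr_ge0 //; apply: G_mono (us m).
      exact: (u_le (leq0n m)).
    by lra.
  apply: leeD => //.
  apply: (@le_trans _ _ (\int[mu]_(x in D) (cst (G (u m%:R))%:E x))%E).
    by rewrite integral_cst // [X in (_ * X)%E]muD.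
  apply: ge0_le_integral => //.
  - by move=> x _; rewrite lee_fin.
  - by move=> x [/= + _]; rewrite lee_fin; exact: G_ge.
apply: le_trans (key N 0%N); rewrite lee_fin.
rewrite mulr_sumr -[leLHS]add0r; apply: lerD.
  by rewrite mulr_ge0 ?subr_ge0.
apply: ler_sum => k _; rewrite add0n weightS mulrCA ler_wpM2l //.
have e1 : expR (-1) <= 2^-1 :> R.
  rewrite expRN lef_pV2 ?posrE ?expR_gt0 //.
  by have := expR_ge1Dx (1 : R); lra.
have := expR_gt0 (- k%:R : R); nra.
Qed.

End ExponentialQuantiles.

(** * From the increments of the quantiles to the entropy inequality *)

(** The constant of [weighted_entropy_le] at [C = 1 + (t0 ^+ 2)^-1], the value provided by
    [min1_sqr_le_cost]. *)
Definition half_line_const {R : realType} (t0 : R) : R :=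
  2 + 12 * (1 + (t0 ^+ 2)^-1) * (expR 1 + 3 * expR 9).

Lemma half_line_const_gt0 {R : realType} (t0 : R) : 0 < half_line_const t0.
Proof.
have : 0 <= (t0 ^+ 2)^-1 by rewrite invr_ge0 sqr_ge0.
have := expR_gt0 (1 : R); have := expR_gt0 (9 : R) => *.
by rewrite ltr_wpDr // !mulr_ge0 //; lra.
Qed.

Section HalfLine.
Context {R : realType} (H : R -> R) (t0 : R).
Hypothesis H_ge0 : forall x, 0 <= H x.
Hypothesis H_even : forall x, H (- x) = H x.
Hypothesis H_convex : convex_fun H.
Hypothesis t0_gt0 : 0 < t0.
Hypothesis H_near0 :
  forall x : R, - (2 * t0) <= x <= 2 * t0 -> H x = 4^-1 * x ^+ 2.
Hypothesis legendre_superlinear :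
  (fun x => legendre H x / x) x @[x --> +oo] --> +oo.

Local Notation w k := (expR (- k%:R : R)).

(** In the quadratic regime of [cost_ge_min], [2 * d <= C] gives [(p * d)^2 <= (C * p)^2 / 4]; in
    the other one [H >= t0 ^+ 2], and the truncated square is at most 1. *)
Lemma min1_sqr_le_cost (d p C : R) : 0 <= d -> 0 <= p -> 2 * d <= C ->
  Num.min (p * d) 1 ^+ 2 <= (1 + (t0 ^+ 2)^-1) * H (C * p).
Proof.
move=> d0 p0 dC.
have t02 : 0 < t0 ^+ 2 by rewrite exprn_gt0.
have it02 : 0 < (t0 ^+ 2)^-1 by rewrite invr_gt0.
have pd : 0 <= p * d by rewrite mulr_ge0.
have H1 := H_ge0 (C * p).
have := cost_ge_min H_ge0 H_even H_convex t0_gt0 H_near0 (C * p).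
have pdC : p * d <= C * p / 2.
  by rewrite -subr_ge0 (_ : _ - _ = p * (C - 2 * d) / 2) ?divr_ge0 ?mulr_ge0 //;
    [lra|field].
have pdC2 : (p * d) ^+ 2 <= 4^-1 * (C * p) ^+ 2.
  rewrite (_ : 4^-1 * _ = (C * p / 2) ^+ 2); last by field.
  by rewrite ler_sqr ?nnegrE //; lra.
rewrite ge_min => /orP[h|h].
  apply: (@le_trans _ _ ((p * d) ^+ 2)).
    by rewrite ler_sqr ?nnegrE ?ge_min ?lexx // le_min pd ler01.
  by nra.
apply: (@le_trans _ _ 1).
  by rewrite expr_le1 ?ge_min ?lexx ?orbT // le_min pd ler01.
have : (t0 ^+ 2)^-1 * t0 ^+ 2 <= (t0 ^+ 2)^-1 * H (C * p).
  by rewrite ler_wpM2l // ltW.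
by rewrite mulVf ?lt0r_neq0 //; lra.
Qed.

Variables (mu : probability R R) (Y u : R -> R) (b : R).
Hypothesis mY : measurable_fun setT Y.
Hypothesis uQ : exp_quantiles mu Y u.
Hypothesis b_gt0 : 0 < b.

Let D (h : R) := b^-1 * inv_nonneg (legendre H) (t0 ^+ 2 + h).
Hypothesis uD : forall x y : R, 0 <= x -> x < y -> u y - u x <= D (y - x).

(** Chosen so that [kap * (t0 ^+ 2 + n) <= 1 + n / 8], the form required by
    [weighted_entropy_le]. *)
Let kap := (8 + t0 ^+ 2)^-1.

Let kapP : [/\ 0 < kap, kap <= 1, kap <= 8^-1 & kap * t0 ^+ 2 <= 1].
Proof.
have t02 : 0 < t0 ^+ 2 by rewrite exprn_gt0.
have k0 : 0 < kap by rewrite invr_gt0; lra.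
have k8 : kap <= 8^-1 by rewrite lef_pV2 ?posrE; lra.
split=> //; first by lra.
by rewrite mulrC ler_pdivrMr; lra.
Qed.

Let D_young (p n : R) : 0 <= n -> p * D n <= H (p / (b * kap)) + 1 + n / 8.
Proof.
move=> n0; have [k0 k1 k8 kt] := kapP.
have := cost_young_inv H_ge0 H_even t0_gt0 H_near0 legendre_superlinear
  p b_gt0 k0 k1 n0.
have : kap * n <= n / 8 by rewrite [leRHS]mulrC ler_wpM2r.
rewrite /D; lra.
Qed.

Let D_ge0 (n : R) : 0 <= n -> 0 <= D n.
Proof.
move=> n0; apply: mulr_ge0; first by rewrite invr_ge0 ltW.
have t02 : 0 <= t0 ^+ 2 + n by rewrite addr_ge0 // sqr_ge0.
by have [] := legendre_inv H_ge0 H_even t0_gt0 H_near0 legendre_superlinear t02.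
Qed.

Lemma expR_tail_integrable (s : R) : 0 <= s ->
  (\int[mu]_(x in [set x | (u 0 < Y x)%R]) (expR (s * (Y x - u 0)))%:E < +oo)%E.
Proof.
move=> s0.
pose E := expR (H (s / (b * kap)) + 1).
apply: (@le_lt_trans _ _ (expR 1 / 2 * (E * (3 * 1)))%:E); last exact: ltry.
apply: (integral_le_weighted_sum (G := fun y => expR (s * (y - u 0)))
    mY uQ) => [y|x y ux xy||N]; first exact: expR_ge0.
- by rewrite ler_expR ler_wpM2l // lerD2r.
- have mm : measurable_fun setT (fun x => s * (Y x - u 0)).
    by apply: measurable_funM => //; apply: measurable_funB.
  exact: (measurableT_comp (@measurable_expR R) mm).
(* The geometric series of ratio [expR (- 7/8)] is bounded by the recursion lemma with a source
   concentrated at index 0. *)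
pose x (k : nat) := expR (k%:R / 8 : R).
pose y (k : nat) : R := (k == 0%N)%:R.
apply: (@le_trans _ _ (\sum_(k < N.+1) E * (x k * w k))).
  rewrite big_ord_recl /= -[leLHS]add0r; apply: lerD.
    by rewrite !mulr_ge0 ?expR_ge0.
  apply: ler_sum => k _; rewrite /bump /= add1n mulrA ler_wpM2r ?expR_ge0 //.
  rewrite -expRD ler_expR.
  have k0 : (0 : R) < k.+1%:R by rewrite ltr0n.
  have := ler_wpM2l s0 (uD (lexx 0) k0); rewrite subr0 => /le_trans; apply.
  by apply: D_young; exact: ltW.
rewrite -mulr_sumr ler_wpM2l ?expR_ge0 //.
have y1 : \sum_(k < N.+1) y k * w k = 1.
  rewrite big_ord_recl /= big1 ?addr0; last by move=> k _; rewrite mul0r.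
  by rewrite /y eqxx mul1r oppr0 expR0.
rewrite -[X in _ <= _ * X]y1.
apply: (@weighted_sum_recursion _ x y (expR 8^-1)) => [k|k|||k].
- exact: expR_ge0.
- exact: ler0n.
- rewrite -expRD (_ : 8^-1 + -1 = - (7 / 8)); last by field.
  have := expR_ge1Dx (7 / 8 : R); rewrite expRN => e2.
  by rewrite -[leRHS]invf_div lef_pV2 ?posrE ?expR_gt0 //; lra.
- by rewrite /x /y /= mul0r expR0.
- by rewrite /x /y /= addr0 -expRD -natr1 mulrDl addrC mul1r.
Qed.

Variables (psi dpsi : R -> R).
Hypothesis mpsi : measurable_fun setT psi.
Hypothesis mdpsi : measurable_fun setT dpsi.
Hypothesis tangent : forall x y, psi x + dpsi x * (y - x) <= psi y.
Hypothesis psi_u0 : psi (u 0) = 0.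

Let dpsi_mono (x y : R) : x <= y -> dpsi x <= dpsi y.
Proof.
rewrite le_eqVlt => /orP[/eqP -> //|xy].
have := tangent x y; have := tangent y x; nra.
Qed.

Let dpsi_gt0 (x : R) : u 0 <= x -> 0 < psi x -> 0 < dpsi x.
Proof. by move=> ux px; have := tangent x (u 0); rewrite psi_u0; nra. Qed.

Let psi_mono (x y : R) : u 0 <= x -> x <= y -> Num.max (psi x) 0 <= Num.max (psi y) 0.
Proof.
move=> ux xy; have [px|px] := leP (psi x) 0; first by rewrite le_max lexx orbT.
have := dpsi_gt0 ux px; have := tangent x y; rewrite le_max => h1 h2.
by apply/orP; left; nra.
Qed.

(** A slope of the positive part of [psi] to the right of [u 0]. Unlike [dpsi], it is nonnegative
    there, so the cost built from it is nondecreasing, as [weighted_sum_le_integral] requires. *)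
Let q (x : R) := if 0 < psi x then dpsi x else 0.

Let q_ge0 (x : R) : u 0 <= x -> 0 <= q x.
Proof.
by move=> ux; rewrite /q; case: ifPn => // px; exact: ltW (dpsi_gt0 ux px).
Qed.

Let q_mono (x y : R) : u 0 <= x -> x <= y -> q x <= q y.
Proof.
move=> ux xy; rewrite {1}/q; case: ifPn => px; last exact: q_ge0 (le_trans ux xy).
have := psi_mono ux xy; rewrite (max_l (ltW px)) le_max => h.
have py : 0 < psi y.
  by case/orP: h => [|]; [exact: lt_le_trans|rewrite leNgt px].
by rewrite /q py dpsi_mono.
Qed.

(** On [u 0 <= Y], of mass at least 1/2, the slope is at least [dpsi (u 0)] and [psi] is
    nonnegative. This pays for the negative part later. *)
Lemma cost_slope_integral (C : R) : 0 <= dpsi (u 0) -> 0 <= C ->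
  ((2^-1 * H (C * dpsi (u 0)))%:E <=
   \int[mu]_x (H (C * dpsi (Y x)) * expR (psi (Y x)))%:E)%E.
Proof.
move=> dp C0.
have mD := measurable_superlevel_ge (u 0) mY.
have mF : measurable_fun setT
    (EFin \o (fun x => H (C * dpsi (Y x)) * expR (psi (Y x)))).
  apply/measurable_EFinP; apply: measurable_funM.
    have mH : measurable_fun setT H.
      by apply: continuous_measurable_fun; exact: convex_fun_continuous.
    have mm : measurable_fun setT (fun x => C * dpsi (Y x)).
      by apply: measurable_funM => //; exact: (measurableT_comp mdpsi).
    exact: (measurableT_comp mH mm).
  exact: (measurableT_comp (@measurable_expR R) (measurableT_comp mpsi mY)).
apply: (@le_trans _ _ (\int[mu]_(x in [set x | (u 0 <= Y x)%R])
    (H (C * dpsi (Y x)) * expR (psi (Y x)))%:E)%E); last first.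
  apply: ge0_subset_integral => //.
  by move=> x _; rewrite lee_fin mulr_ge0 ?expR_ge0.
apply: (@le_trans _ _ (\int[mu]_(x in [set x | (u 0 <= Y x)%R])
    (cst (H (C * dpsi (u 0)))%:E x))%E); last first.
  apply: ge0_le_integral => //.
  - by move=> x _; rewrite lee_fin.
  - exact: (measurable_funS measurableT _ mF).
  move=> x /= ux; rewrite lee_fin -[leLHS]mulr1.
  have hd := dpsi_mono ux.
  apply: ler_pM => //.
    apply: (cost_mono H_ge0 H_even H_convex t0_gt0 H_near0).
    by rewrite !ger0_norm ?mulr_ge0 ?ler_wpM2l // (le_trans dp).
  rewrite -expR0 ler_expR; have := tangent (u 0) (Y x); rewrite psi_u0; nra.
rewrite integral_cst //.
apply: (@le_trans _ _ ((H (C * dpsi (u 0)))%:E * 2^-1%:E)%E).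
  by rewrite -EFinM mulrC.
rewrite lee_wpmul2l ?lee_fin //.
have [_] := uQ (lexx 0); rewrite oppr0 expR0 div1r; exact: le_trans.
Qed.

(** [C] must exceed [(b * kap)^-1] for the Fenchel-Young step and [2 * D 1] for [min1_sqr_le_cost].
    The factor [2 * expR 1] is [expR 1 / 2] from the upper comparison with sums times 4 from the
    lower one. *)
Lemma half_line_entropy_le (C : R) : (b * kap)^-1 + 2 * D 1 <= C ->
  (\int[mu]_(x in [set x | (u 0 < Y x)%R])
     (entropy_fun (Num.max (psi (Y x)) 0))%:E <=
   (2 * expR 1 * half_line_const t0)%:E *
   \int[mu]_x (H (C * dpsi (Y x)) * expR (psi (Y x)))%:E)%E.
Proof.
move=> hC; set K := half_line_const t0.
have [k0 k1 k8 kt] := kapP.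
have D1 : 0 <= D 1 by exact: D_ge0.
have bk0 : 0 < (b * kap)^-1 by rewrite invr_gt0 mulr_gt0.
have C0 : 0 <= C by lra.
have K0 : 0 <= K by exact: ltW (half_line_const_gt0 t0).
have mD := measurable_superlevel_ge (u 0) mY.
have mH : measurable_fun setT H.
  by apply: continuous_measurable_fun; exact: convex_fun_continuous.
have mF : measurable_fun setT (fun x => H (C * dpsi (Y x)) * expR (psi (Y x))).
  apply: measurable_funM.
    have mm : measurable_fun setT (fun x => C * dpsi (Y x)).
      by apply: measurable_funM => //; exact: (measurableT_comp mdpsi).
    exact: (measurableT_comp mH mm).
  exact: (measurableT_comp (@measurable_expR R) (measurableT_comp mpsi mY)).
pose G x := H (C * q x) * expR (Num.max (psi x) 0).
have mG : measurable_fun setT G.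
  apply: measurable_funM.
    have mm : measurable_fun setT (fun x => C * q x).
      apply: measurable_funM => //.
      by apply: measurable_fun_ifT => //; exact: measurable_fun_ltr.
    exact: (measurableT_comp mH mm).
  have mm : measurable_fun setT (fun x => Num.max (psi x) 0).
    exact: measurable_maxr.
  exact: (measurableT_comp (@measurable_expR R) mm).
have G_ge0 x : 0 <= G x by rewrite mulr_ge0 ?expR_ge0.
have G_mono x y : u 0 <= x -> x <= y -> G x <= G y.
  move=> ux xy; apply: ler_pM; rewrite ?expR_ge0 //.
    apply: (cost_mono H_ge0 H_even H_convex t0_gt0 H_near0).
    have qx := q_ge0 ux; have qxy := q_mono ux xy.
    by rewrite !ger0_norm ?mulr_ge0 ?ler_wpM2l // (le_trans qx).
  by rewrite ler_expR psi_mono.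
set I := (\int[mu]_x (H (C * dpsi (Y x)) * expR (psi (Y x)))%:E)%E.
have I0 : (0 <= I)%E.
  by apply: integral_ge0 => x _; rewrite lee_fin mulr_ge0 ?expR_ge0.
have GI : (\int[mu]_(x in [set x | (u 0 <= Y x)%R]) (G (Y x))%:E <= I)%E.
  apply: (@le_trans _ _ (\int[mu]_(x in [set x | (u 0 <= Y x)%R])
      (H (C * dpsi (Y x)) * expR (psi (Y x)))%:E)%E); last first.
    apply: ge0_subset_integral => //; first by apply/measurable_EFinP.
    by move=> x _; rewrite lee_fin mulr_ge0 ?expR_ge0.
  apply: ge0_le_integral => //.
  - by move=> x _; rewrite lee_fin.
  - apply: measurable_funTS; apply/measurable_EFinP.
    exact: (measurableT_comp mG).
  - by apply: measurable_funTS; apply/measurable_EFinP.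
  move=> x /= ux; rewrite lee_fin /G /q; case: ifPn => px.
    by rewrite max_l // ltW.
  by rewrite mulr0 (cost0 t0_gt0 H_near0) mul0r mulr_ge0 ?expR_ge0.
have [Ifin|] := boolP (I \is a fin_num); last first.
  rewrite ge0_fin_numE // -leNgt leye_eq => /eqP ->.
  have : 0 < 2 * expR 1 * K by rewrite !mulr_gt0 ?expR_gt0 ?half_line_const_gt0.
  by move=> h; rewrite gt0_muley ?lte_fin // leey.
rewrite -(fineK Ifin) -EFinM.
rewrite (_ : 2 * expR 1 * K * fine I = expR 1 / 2 * (K * (4 * fine I))); last first.
  by field.
have us k : u 0 <= u k%:R.
  case: k => [//|k]; exact: (exp_quantiles_le mY uQ).
have us1 k : u k%:R <= u k.+1%:R.
  by apply: (exp_quantiles_le mY uQ) => //; rewrite ltr_nat.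
apply: (integral_le_weighted_sum
  (G := fun y => entropy_fun (Num.max (psi y) 0)) mY uQ) => [y|x y ux xy||N].
- exact: entropy_fun_ge0.
- apply: entropy_fun_mono; first by rewrite le_max lexx orbT.
  exact: psi_mono.
- have mm : measurable_fun setT (fun x => Num.max (psi (Y x)) 0).
    by apply: measurable_maxr => //; exact: (measurableT_comp mpsi).
  have me := measurableT_comp (@measurable_expR R) mm.
  apply: measurable_funD => //; apply: measurable_funB => //.
  exact: measurable_funM.
pose f (k : nat) := Num.max (psi (u k%:R)) 0.
pose p (k : nat) := q (u k%:R).
have p0 k : 0 <= p k by exact: q_ge0.
have f_diff j k : (j < k)%N -> f k - f j <= p k * D (k%:R - j%:R).
  move=> jk.
  have ujk : u k%:R - u j%:R <= D (k%:R - j%:R).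
    by apply: uD => //; rewrite ltr_nat.
  apply: (@le_trans _ _ (p k * (u k%:R - u j%:R))); last by rewrite ler_wpM2l.
  rewrite /f /p /q; case: ifPn => pk; last first.
    rewrite -leNgt in pk.
    by rewrite (max_r pk) mul0r sub0r oppr_le0 le_max lexx orbT.
  rewrite (max_l (ltW pk)).
  have : psi (u j%:R) <= Num.max (psi (u j%:R)) 0 by rewrite le_max lexx.
  have := tangent (u k%:R) (u j%:R); lra.
apply: (@le_trans _ _ (K * \sum_(k < N.+1) G (u k%:R) * w k)).
  apply: (@le_trans _ _ (\sum_(k < N.+1) entropy_fun (f k) * w k)).
    rewrite [leRHS]big_ord_recl /= {1}/f psi_u0 maxxx entropy_fun0 mul0r add0r.
    by apply: ler_sum => k _; rewrite /bump /= add1n.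
  have := @weighted_entropy_le _ f (fun k => p k * D 1) (fun k => H (C * p k))
    (1 + (t0 ^+ 2)^-1) N.+1.
  apply.
  - by rewrite /f psi_u0 maxxx.
  - by move=> k; exact: psi_mono.
  - by [].
  - by move=> k; rewrite mulr_ge0.
  - move=> k; have := f_diff _ _ (ltnSn k).
    by rewrite -natr1 (_ : k%:R + 1 - k%:R = 1) //; ring.
  - by move=> k; apply: min1_sqr_le_cost => //; lra.
  move=> j k jk; apply: (le_trans (f_diff _ _ jk)).
  have jk0 : 0 <= k%:R - j%:R :> R by rewrite subr_ge0 ler_nat ltnW.
  apply: (le_trans (D_young (p k) jk0)); rewrite !lerD2r.
  apply: (cost_mono H_ge0 H_even H_convex t0_gt0 H_near0).
  rewrite !ger0_norm ?mulr_ge0 ?(ltW bk0) //.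
  by rewrite mulrC ler_wpM2r //; lra.
rewrite ler_wpM2l // -ler_pdivrMl // -lee_fin fineK //.
apply: le_trans GI.
exact: (weighted_sum_le_integral mY uQ G_ge0 G_mono (measurableT_comp mG mY)).
Qed.

End HalfLine.

(** * Tangents of convex functions, exponential moments, and a variational bound on entropy *)

Section ConvexTangent.
Context {R : realType}.

Lemma convex_fun_tangent (f : R -> R) (x y : R) : convex_fun f ->
  derivable f x 1 -> f x + derive1 f x * (y - x) <= f y.
Proof.
move=> cf df; have [->|xy] := eqVneq y x; first by rewrite subrr mulr0 addr0.
(* Steps towards [y] treat both signs of [y - x] at once; along them the difference quotient times
   [y - x] stays below the chord [f y - f x]. *)
pose h (n : nat) := n.+1%:R^-1 * (y - x).
have yx : y - x != 0 by rewrite subr_eq0.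
have h0 : h n @[n --> \oo] --> 0.
  rewrite -(mul0r (y - x)); apply: cvgMl => //.
  exact: (@cvg_harmonic R).
have hN0 n : h n != 0 by rewrite mulf_neq0 // invr_eq0 pnatr_eq0.
have : (h n)^-1 * (f (h n + x) - f x) @[n --> \oo] --> derive1 f x.
  have : h^-1 *: (f (h + x) - f x) @[h --> 0^'] --> derive1 f x.
    by have := df; rewrite /derivable /=; under eq_fun do rewrite [_ *: 1]mulr1.
  by move=> /cvgr_dnbhsP; apply.
move=> /cvgM/(_ (cvg_cst (y - x))) lim.
suff : derive1 f x * (y - x) <= f y - f x by lra.
apply: (cvgr_to_le lim); apply: nearW => n.
have n1 : (0 : R) < n.+1%:R by rewrite ltr0n.
have in0 : (0 : R) <= n.+1%:R^-1 by rewrite invr_ge0 ltW.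
have in1 : (n.+1%:R^-1 : R) <= 1 by rewrite invf_le1 // ler1n.
have := cf y x _ in0 in1.
rewrite (_ : _ * y + _ * x = h n + x); last by rewrite /h; ring.
rewrite -(ler_pM2l n1) => le1.
rewrite [leLHS]/= {1}/h invfM invrK.
move: (f (h n + x)) n1 le1 => F; move: (n.+1%:R : R) => N N0.
rewrite (_ : N * (_ * f y + _) = f y + N * f x - f x); last first.
  by field; exact: lt0r_neq0.
rewrite (_ : _ * _ * (y - x) = N * F - N * f x); first by lra.
by field.
Qed.

Lemma lipschitzR_const (f : R -> R) : lipschitz f ->
  exists2 L, 0 < L & forall x y, `|f x - f y| <= L * `|x - y|.
Proof.
move=> [M [_ hM]]; exists (`|M| + 1); first by rewrite ltr_wpDl.
move=> x y.
have /hM : M < `|M| + 1 by have := ler_norm M; lra.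
by move=> /(_ (x, y)); apply.
Qed.

Lemma derivable_continuousR (f : R -> R) : (forall x, derivable f x 1) ->
  continuous f.
Proof. by move=> df x; apply/differentiable_continuous/derivable1_diffP. Qed.

End ConvexTangent.

Section ExponentialMoments.
Context {R : realType} (mu : probability R R).

Lemma integralR (f : R -> R) : mu.-integrable setT (EFin \o f) ->
  (\int[mu]_x (f x)%:E)%E = (\int[mu]_x f x)%:E.
Proof. by move=> If; rewrite /Rintegral fineK //; exact: integrable_fin_num. Qed.

Hypothesis exp_moment :
  forall s : R, 0 < s -> (\int[mu]_x (expR (s * `|x|))%:E < +oo)%E.

Lemma integrable_exp_growth (f : R -> R) (K s : R) : measurable_fun setT f ->
  0 < s -> (forall x, `|f x| <= K * expR (s * `|x|)) ->
  mu.-integrable setT (EFin \o f).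
Proof.
move=> mf s0 fK.
apply: (@le_integrable _ _ _ mu setT measurableT (EFin \o f)
  (EFin \o (fun x : R => K * expR (s * `|x|)))).
- exact/measurable_EFinP.
- move=> x _ /=; rewrite lee_fin (le_trans (fK x)) //; exact: ler_norm.
apply: (@integrableZl _ _ _ mu setT measurableT K
  (EFin \o (fun x : R => expR (s * `|x|)))).
have ms : measurable_fun setT (fun x : R => s * `|x|).
  by apply: measurable_funM => //; exact: normr_measurable.
apply/integrableP; split.
  by apply/measurable_EFinP; exact: (measurableT_comp (@measurable_expR R) ms).
apply: le_lt_trans (exp_moment s0); apply: ge0_le_integral => //.
- by apply: measurableT_comp => //; apply/measurable_EFinP;
    exact: (measurableT_comp (@measurable_expR R) ms).
- by apply/measurable_EFinP; exact: (measurableT_comp (@measurable_expR R) ms).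
- by move=> x _ /=; rewrite lee_fin ger0_norm ?expR_ge0.
Qed.

Section LipschitzExponential.
Variables (phi : R -> R) (L : R).
Hypothesis mphi : measurable_fun setT phi.
Hypothesis L_gt0 : 0 < L.
Hypothesis phi_lip : forall x y, `|phi x - phi y| <= L * `|x - y|.

Let phi_le x : `|phi x| <= `|phi 0| + L * `|x|.
Proof.
have := phi_lip x 0; rewrite subr0 => h.
have := ler_normD (phi x - phi 0) (phi 0); rewrite subrK; lra.
Qed.

Lemma integrable_expR_lipschitz :
  mu.-integrable setT (EFin \o (fun x => expR (phi x))).
Proof.
apply: (integrable_exp_growth (K := expR `|phi 0|) (s := L)) => //.
  exact: (measurableT_comp (@measurable_expR R) mphi).
move=> x; rewrite ger0_norm ?expR_ge0 // -expRD ler_expR.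
exact: le_trans (ler_norm _) (phi_le x).
Qed.

Lemma integrable_expRM_lipschitz :
  mu.-integrable setT (EFin \o (fun x => expR (phi x) * phi x)).
Proof.
apply: (integrable_exp_growth (K := expR (2 * `|phi 0|)) (s := 2 * L)).
- apply: measurable_funM => //.
  exact: (measurableT_comp (@measurable_expR R) mphi).
- by rewrite mulr_gt0.
move=> x; rewrite normrM (ger0_norm (expR_ge0 _)) -expRD.
apply: (@le_trans _ _ (expR `|phi x| * expR `|phi x|)).
  apply: ler_pM; rewrite ?expR_ge0 ?ler_expR ?ler_norm //.
  by have := expR_ge1Dx `|phi x|; lra.
rewrite -expRD ler_expR; have := phi_le x; lra.
Qed.

Lemma EntE : Ent mu (fun x => expR (phi x)) =
  (\int[mu]_x (expR (phi x) * phi x) -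
   (\int[mu]_x expR (phi x)) * ln (\int[mu]_x expR (phi x)))%:E.
Proof.
rewrite /Ent /=; under eq_integral do rewrite expRK.
by rewrite (integralR integrable_expRM_lipschitz) ltry -EFinB.
Qed.

(** The right side equals [E[phi * exp phi] - (1 + a) * J + exp a] with [J = E[exp phi]], and
    [(1 + a) * J - exp a <= J * ln J] is the convex duality between [exp] and [x * ln x]. *)
Lemma Ent_le_entropy_fun (a : R) : (Ent mu (fun x => expR (phi x)) <=
  (expR a)%:E * \int[mu]_x (entropy_fun (phi x - a))%:E)%E.
Proof.
rewrite EntE; have I1 := integrable_expRM_lipschitz.
have I2 := integrable_expR_lipschitz.
set J := Rintegral mu setT (fun x => expR (phi x)).
have -> : (fun x => (entropy_fun (phi x - a))%:E) =
    EFin \o (fun x => (expR (- a) * (expR (phi x) * phi x) -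
      (expR (- a) * (1 + a)) * expR (phi x)) + 1).
  by apply/funext => x /=; congr EFin; rewrite /entropy_fun expRD; ring.
have J1 : mu.-integrable setT
    (EFin \o (fun x => expR (- a) * (expR (phi x) * phi x))).
  exact: (@integrableZl _ _ _ mu setT measurableT (expR (- a)) _ I1).
have J2 : mu.-integrable setT
    (EFin \o (fun x => (expR (- a) * (1 + a)) * expR (phi x))).
  exact: (@integrableZl _ _ _ mu setT measurableT (expR (- a) * (1 + a)) _ I2).
have J12 : mu.-integrable setT (EFin \o (fun x =>
    expR (- a) * (expR (phi x) * phi x) -
    (expR (- a) * (1 + a)) * expR (phi x))).
  exact: (integrableB measurableT J1 J2).
have J3 : mu.-integrable setT (EFin \o (fun _ : R => (1 : R))).
  exact: finite_measure_integrable_cst.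
have J4 := integrableD measurableT J12 J3.
rewrite (integralR J4) -EFinM lee_fin.
rewrite (RintegralD measurableT J12 J3) (RintegralB measurableT J1 J2).
rewrite (RintegralZl _ measurableT I1) (RintegralZl _ measurableT I2).
have -> : \int[mu]_x (1 : R) = 1.
  rewrite Rintegral_cst // mul1r -[RHS]/(fine 1%E); congr fine.
  exact: probability_setT.
rewrite -/J.
rewrite (_ : expR a * _ = \int[mu]_x (expR (phi x) * phi x) -
    (1 + a) * J + expR a); last first.
  by rewrite expRN; field; rewrite lt0r_neq0 // expR_gt0.
rewrite -addrA lerD2l.
have J0 : 0 <= J by apply: Rintegral_ge0 => x _; exact: expR_ge0.
have [J_eq0|JN0] := eqVneq J 0.
  by rewrite J_eq0 mul0r mulr0 oppr0 add0r expR_ge0.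
have J_gt0 : 0 < J by rewrite lt_neqAle eq_sym JN0.
have := expR_ge1Dx (a - ln J); rewrite expRD expRN lnK ?posrE //.
rewrite -(ler_pM2l J_gt0) mulrCA divff // mulr1; lra.
Qed.

End LipschitzExponential.
End ExponentialMoments.

(** * Gluing the two half-lines *)

Lemma measurable_EFin_comp d (T : measurableType d) {R : realType} (D : set T)
  (f : T -> R) : measurable_fun setT f -> measurable_fun D (EFin \o f).
Proof. by move=> mf; apply: measurable_funTS; apply/measurable_EFinP. Qed.

(** A possible atom at [m] is kept apart because the tail estimates concern open half-lines only. *)
Lemma integral_split_at {R : realType} (mu : probability R R) (F : R -> R)
    (m : R) : measurable_fun setT F -> (forall x, 0 <= F x) ->
  (\int[mu]_x (F x)%:E = \int[mu]_(x in [set x | (m < x)%R]) (F x)%:E +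
    \int[mu]_(x in [set x | (- m < - x)%R]) (F x)%:E + (F m)%:E * mu [set m])%E.
Proof.
move=> mF F0.
have mE D : measurable_fun D (EFin \o F).
  by exact: (measurable_EFin_comp mF).
have m1 := measurable_superlevel m (@measurable_id _ R setT).
have m2 := measurable_superlevel (- m) (@oppr_measurable R setT).
have -> : [set: R] = ([set x | m < x] `|` [set x | - m < - x]) `|` [set m].
  apply/seteqP; split=> // x _ /=; rewrite ltrN2.
  by case: (ltgtP m x) => [||->]; [left; left|left; right|right].
rewrite ge0_integral_setU //; last 3 first.
- exact: measurableU.
- by move=> x _; rewrite lee_fin.
- rewrite disj_set2E; apply/eqP/seteqP; split => // x [xD xm].
  by move: xD; rewrite /= (xm : x = m) !ltxx => -[].
rewrite ge0_integral_setU //; last 2 first.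
- by move=> x _; rewrite lee_fin.
- rewrite disj_set2E; apply/eqP/seteqP; split => // x [/= mx].
  by rewrite ltrN2 => /(lt_trans mx); rewrite ltxx.
congr (_ + _)%E.
rewrite -(integral_cst mu (measurable_set1 m)).
by apply: eq_integral => x; rewrite inE /= => ->.
Qed.

Lemma measurable_entropy_fun {R : realType} :
  measurable_fun setT (@entropy_fun R).
Proof.
apply: measurable_funD => //; apply: measurable_funB => //.
by apply: measurable_funM => //; exact: measurable_expR.
Qed.

Section DeltaToEntropy.
Context {R : realType} (H : R -> R) (t0 : R).
Hypothesis H_ge0 : forall x, 0 <= H x.
Hypothesis H_even : forall x, H (- x) = H x.
Hypothesis H_convex : convex_fun H.
Hypothesis t0_gt0 : 0 < t0.
Hypothesis H_near0 :
  forall x : R, - (2 * t0) <= x <= 2 * t0 -> H x = 4^-1 * x ^+ 2.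
Hypothesis legendre_superlinear :
  (fun x => legendre H x / x) x @[x --> +oo] --> +oo.
Variables (mu : probability R R) (b : R).
Hypothesis b_gt0 : 0 < b.

Let D (h : R) := b^-1 * inv_nonneg (legendre H) (t0 ^+ 2 + h).
Hypothesis hD : forall h : R, 0 < h -> (Delta mu h <= (D h)%:E)%E.

Local Notation m := (U_map mu 0).

Let U_incr (x h : R) : 0 < h -> U_map mu (x + h) - U_map mu x <= D h.
Proof.
move=> h0; rewrite -lee_fin; apply: le_trans (hD h0).
by apply: ereal_sup_ubound; exists x.
Qed.

Let uD_right (x y : R) : 0 <= x -> x < y -> U_map mu y - U_map mu x <= D (y - x).
Proof.
move=> _ xy; have yx : 0 < y - x by rewrite subr_gt0.
have := U_incr x yx; by rewrite (_ : x + (y - x) = y) //; ring.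
Qed.

Let uD_left (x y : R) : 0 <= x -> x < y ->
  - U_map mu (- y) - - U_map mu (- x) <= D (y - x).
Proof.
move=> _ xy; have yx : 0 < y - x by rewrite subr_gt0.
have := U_incr (- y) yx; rewrite (_ : - y + (y - x) = - x); last by ring.
by lra.
Qed.

Let uQ_right : exp_quantiles mu (fun x => x) (U_map mu).
Proof. by move=> x x0; exact: U_map_tail. Qed.

Let uQ_left : exp_quantiles mu (fun x => - x) (fun x => - U_map mu (- x)).
Proof. by move=> x x0; exact: U_map_tail_opp. Qed.

Let mN : measurable_fun setT (fun x : R => - x).
Proof. exact: oppr_measurable. Qed.

Lemma Delta_exp_moment (s : R) : 0 < s ->
  (\int[mu]_x (expR (s * `|x|))%:E < +oo)%E.
Proof.
move=> s0.
have mf : measurable_fun setT (fun x : R => expR (s * `|x - m|)).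
  have ms : measurable_fun setT (fun x : R => s * `|x - m|).
    apply: measurable_funM => //.
    by apply: (measurableT_comp (@normr_measurable R setT));
      apply: measurable_funB.
  exact: (measurableT_comp (@measurable_expR R) ms).
have mg : measurable_fun setT (fun x : R => expR (s * `|x|)).
  have ms : measurable_fun setT (fun x : R => s * `|x|).
    by apply: measurable_funM => //; exact: normr_measurable.
  exact: (measurableT_comp (@measurable_expR R) ms).
apply: (@le_lt_trans _ _ (\int[mu]_x ((expR (s * `|m|))%:E *
    (expR (s * `|x - m|))%:E))%E).
  apply: ge0_le_integral => //.
  - exact: (measurable_EFin_comp mg).
  - apply: (emeasurable_funM (f := cst _)) => //; exact: (measurable_EFin_comp mf).
  move=> x _; rewrite -EFinM lee_fin -expRD ler_expR -mulrDr ler_wpM2l ?(ltW s0) //.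
  by have := ler_normD m (x - m); rewrite addrC subrK.
rewrite ge0_integralZl_EFin ?expR_ge0 //; last exact: (measurable_EFin_comp mf).
suff : (\int[mu]_x (expR (s * `|x - m|))%:E < +oo)%E.
  by move=> fin; rewrite lte_mul_pinfty ?lee_fin ?expR_ge0.
rewrite (integral_split_at mu m mf) => [|x]; last exact: expR_ge0.
apply: lte_add_pinfty; first apply: lte_add_pinfty.
- have := expR_tail_integrable H_ge0 H_even t0_gt0 H_near0 legendre_superlinear
    (@measurable_id _ _ setT) uQ_right b_gt0 uD_right (ltW s0).
  apply: le_lt_trans; rewrite le_eqVlt; apply/orP; left; apply/eqP.
  apply: eq_integral => x; rewrite inE /= => mx.
  by rewrite gtr0_norm // subr_gt0.
- have := expR_tail_integrable H_ge0 H_even t0_gt0 H_near0 legendre_superlinear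
    mN uQ_left b_gt0 uD_left (ltW s0).
  rewrite oppr0.
  apply: le_lt_trans; rewrite le_eqVlt; apply/orP; left; apply/eqP.
  apply: eq_integral => x; rewrite inE /= => mx.
  by rewrite ltrN2 in mx; rewrite ltr0_norm ?subr_lt0 // opprB opprK addrC.
- rewrite subrr normr0 mulr0 expR0 mul1e.
  by rewrite (le_lt_trans _ (ltry 1)) // probability_le1.
Qed.

(** For [t <= 0], [entropy_fun t] is at most both 1 and [t ^+ 2]. The form [N * 1] matches
    [min1_sqr_le_cost] at [d = 1], and the factor in [x] is integrable. *)
Lemma entropy_fun_min_le (g : R -> R) (N x : R) : 0 <= N ->
  (- (N * `|x - m|) <= g x) ->
  entropy_fun (Num.min (g x) 0) <= Num.min (N * 1) 1 ^+ 2 * (1 + (x - m) ^+ 2).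
Proof.
move=> N0 gN; rewrite mulr1.
have [gx|gx] := leP (g x) 0; last first.
  by rewrite entropy_fun0 mulr_ge0 ?sqr_ge0 // addr_ge0 // sqr_ge0.
have := sqr_ge0 (x - m) => xm.
have e1 := expR_ge1Dx (g x); have e0 := expR_gt0 (g x).
have [N1|N1] := leP N 1; last first.
  rewrite expr1n mul1r; apply: (@le_trans _ _ 1); last by lra.
  by rewrite /entropy_fun; nra.
apply: (@le_trans _ _ ((g x) ^+ 2)).
  by apply: (le_trans (entropy_fun_le_sqr _)); nra.
apply: (@le_trans _ _ (N ^+ 2 * (x - m) ^+ 2)).
  rewrite -(real_normK (num_real (x - m))) -exprMn -sqrrN.
  rewrite ler_sqr ?nnegrE ?oppr_ge0 ?mulr_ge0 //; lra.
by rewrite ler_wpM2l ?sqr_ge0 //; lra.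
Qed.

Lemma Delta_entropy_bound : exists c : R, 0 < c /\
  forall phi : R -> R, smooth phi -> convex_fun phi -> lipschitz phi ->
    (Ent mu (fun x => expR (phi x))
     <= \int[mu]_x (H (c * derive1 phi x) * expR (phi x))%:E)%E.
Proof.
pose kap := (8 + t0 ^+ 2)^-1.
have t02 : 0 < t0 ^+ 2 by rewrite exprn_gt0.
have kap0 : 0 < kap by rewrite invr_gt0; lra.
have bk0 : 0 < (b * kap)^-1 by rewrite invr_gt0 mulr_gt0.
have D1 : 0 <= D 1.
  have h : 0 <= t0 ^+ 2 + 1 by lra.
  have [h1 _] := legendre_inv H_ge0 H_even t0_gt0 H_near0 legendre_superlinear h.
  by rewrite mulr_ge0 // invr_ge0 ltW.
(* The last 2 allows [min1_sqr_le_cost] at [d = 1], for the negative part. *)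
pose C := (b * kap)^-1 + 2 * D 1 + 2.
have C0 : 0 < C by rewrite /C; lra.
have hC : (b * kap)^-1 + 2 * D 1 <= C by rewrite /C; lra.
have mX2 : measurable_fun setT (fun x : R => 1 + (x - m) ^+ 2).
  by apply: measurable_funD => //; apply: measurable_funX;
    apply: measurable_funB.
have IX2 : mu.-integrable setT (EFin \o (fun x => 1 + (x - m) ^+ 2)).
  apply: (integrable_exp_growth Delta_exp_moment
    (K := 3 * expR `|m|) (s := 1)) => // x.
  have h0 := normr_ge0 (x - m).
  have h1 : 1 + (x - m) ^+ 2 / 2 <= expR `|x - m|.
    by rewrite -[(x - m) ^+ 2]real_normK ?num_real //; exact: (expR_ge1Dxn 1).
  have h2 : expR `|x - m| <= expR `|m| * expR `|x|.
    by rewrite -expRD ler_expR; have := ler_normB x m; lra.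
  have h3 : 1 <= expR `|x - m| by rewrite -expR0 ler_expR.
  rewrite mul1r ger0_norm ?addr_ge0 ?sqr_ge0 //.
  lra.
pose M := \int[mu]_x (1 + (x - m) ^+ 2).
have M0 : 0 <= M by apply: Rintegral_ge0 => x _; rewrite addr_ge0 ?sqr_ge0.
pose K1 := 2 * expR 1 * half_line_const t0.
have K1_gt0 : 0 < K1 by rewrite !mulr_gt0 ?expR_gt0 ?half_line_const_gt0.
pose K2 := 1 + (t0 ^+ 2)^-1.
have K2_gt0 : 0 < K2 by rewrite ltr_wpDr // invr_ge0 ltW.
(* One [K1] per half-line and [K2 * 2 * M] for the negative part, where 2 undoes the 1/2 of
   [cost_slope_integral]; the 1 ensures [K >= 1], so that [cost_mulr_ge] moves [K] inside [H]. *)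
pose K := 1 + K1 + K1 + K2 * 2 * M.
have K_ge1 : 1 <= K.
  by have : 0 <= K2 * 2 * M; [rewrite !mulr_ge0 // ltW|rewrite /K; lra].
exists (K * C); split; first by rewrite mulr_gt0 //; lra.
move=> phi sphi cphi lphi.
have [L L0 hL] := lipschitzR_const lphi.
have dphi x : derivable phi x 1 by exact: (sphi 0%N).
have mphi : measurable_fun setT phi.
  by apply: continuous_measurable_fun; exact: derivable_continuousR.
have mdphi : measurable_fun setT (derive1 phi).
  apply: continuous_measurable_fun; apply: derivable_continuousR => x.
  exact: (sphi 1%N).
have tangent x y := convex_fun_tangent y cphi (dphi x).
pose g x := phi x - phi m.
have mg : measurable_fun setT g by apply: measurable_funB.
pose F x := H (C * derive1 phi x) * expR (g x).
have F0 x : 0 <= F x by rewrite mulr_ge0 ?expR_ge0.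
have mH : measurable_fun setT H.
  by apply: continuous_measurable_fun; exact: convex_fun_continuous.
have mF : measurable_fun setT F.
  apply: measurable_funM; last exact: (measurableT_comp (@measurable_expR R) mg).
  have mm : measurable_fun setT (fun x => C * derive1 phi x).
    exact: measurable_funM.
  exact: (measurableT_comp mH mm).
set I := (\int[mu]_x (F x)%:E)%E.
have I0 : (0 <= I)%E by apply: integral_ge0 => x _; rewrite lee_fin.
have g_tangent x y : g x + derive1 phi x * (y - x) <= g y.
  by have := tangent x y; rewrite /g; lra.
have gm0 : g m = 0 by rewrite /g subrr.
pose g' x := g (- x); pose dg' x := - derive1 phi (- x).
have g'_tangent x y : g' x + dg' x * (y - x) <= g' y.
  have := g_tangent (- x) (- y); rewrite /g' /dg'.
  by rewrite (_ : - y - - x = - (y - x)); [rewrite mulrN mulNr|ring].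
have g'm0 : g' (- U_map mu (- 0)) = 0 by rewrite /g' opprK oppr0.
have mg' : measurable_fun setT g' by exact: (measurableT_comp mg mN).
have mdg' : measurable_fun setT dg'.
  exact: (measurableT_comp mN (measurableT_comp mdphi mN)).
have IE : (\int[mu]_x (H (C * dg' (- x)) * expR (g' (- x)))%:E)%E = I.
  apply: eq_integral => x _; congr EFin.
  by rewrite /dg' /g' opprK mulrN H_even.
have pos_right := half_line_entropy_le H_ge0 H_even H_convex t0_gt0 H_near0
  legendre_superlinear (@measurable_id _ _ setT) uQ_right b_gt0 uD_right
  mg mdphi g_tangent gm0 hC.
have pos_left := half_line_entropy_le H_ge0 H_even H_convex t0_gt0 H_near0
  legendre_superlinear mN uQ_left b_gt0 uD_left mg' mdg' g'_tangent g'm0 hC.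
rewrite IE oppr0 in pos_left.
rewrite -/I -/K1 in pos_right; rewrite -/K1 in pos_left.
pose N : R := `|derive1 phi m|.
(* Whatever the sign of the slope at [m], one of the two orientations sees a nonnegative slope
   there. *)
have slope : ((2^-1 * H (C * N))%:E <= I)%E.
  have [d0|d0] := leP 0 (derive1 phi m).
    have := cost_slope_integral H_ge0 H_even H_convex t0_gt0 H_near0
      (@measurable_id _ _ setT) uQ_right mg mdphi g_tangent gm0 d0 (ltW C0).
    by rewrite /N ger0_norm.
  have d0' : 0 <= dg' (- U_map mu (- 0)).
    by rewrite /dg' opprK oppr0 oppr_ge0 ltW.
  have := cost_slope_integral H_ge0 H_even H_convex t0_gt0 H_near0
    mN uQ_left mg' mdg' g'_tangent g'm0 d0' (ltW C0).
  by rewrite IE {1}/dg' opprK oppr0 /N ltr0_norm.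
have mmin : measurable_fun setT (fun x => entropy_fun (Num.min (g x) 0)).
  have mm : measurable_fun setT (fun x => Num.min (g x) 0).
    exact: measurable_minr.
  exact: (measurableT_comp measurable_entropy_fun mm).
have mmax : measurable_fun setT (fun x => entropy_fun (Num.max (g x) 0)).
  have mm : measurable_fun setT (fun x => Num.max (g x) 0).
    exact: measurable_maxr.
  exact: (measurableT_comp measurable_entropy_fun mm).
have neg : (\int[mu]_x (entropy_fun (Num.min (g x) 0))%:E <=
    (K2 * 2 * M)%:E * I)%E.
  apply: (@le_trans _ _ (\int[mu]_x
      (Num.min (N * 1) 1 ^+ 2 * (1 + (x - m) ^+ 2))%:E)%E).
    apply: ge0_le_integral => //.
    - by move=> x _; rewrite lee_fin entropy_fun_ge0.
    - exact: (measurable_EFin_comp mmin).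
    - have mm : measurable_fun setT
          (fun x : R => Num.min (N * 1) 1 ^+ 2 * (1 + (x - m) ^+ 2)).
        exact: measurable_funM.
      exact: (measurable_EFin_comp mm).
    move=> x _; rewrite lee_fin; apply: entropy_fun_min_le; first exact: normr_ge0.
    have := g_tangent m x; rewrite gm0 add0r; apply: le_trans.
    by rewrite /N -normrM lerNl -normrN ler_norm.
  rewrite (integralR (f := fun x => _ * (1 + (x - m) ^+ 2))); last first.
    exact: (@integrableZl _ _ _ mu setT measurableT _ _ IX2).
  rewrite (RintegralZl _ measurableT IX2) -/M.
  have N0 : 0 <= N by exact: normr_ge0.
  have C2 : 2 * 1 <= C by rewrite /C; lra.
  have := min1_sqr_le_cost H_ge0 H_even H_convex t0_gt0 H_near0 ler01 N0 C2.
  rewrite -/K2 => hmin.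
  apply: (@le_trans _ _ ((K2 * 2 * M)%:E * (2^-1 * H (C * N))%:E)%E).
    rewrite -EFinM lee_fin (_ : _ * (2^-1 * _) = (K2 * H (C * N)) * M).
      by rewrite ler_wpM2r.
    by field.
  by rewrite lee_wpmul2l // lee_fin !mulr_ge0 // ltW.
have pos : (\int[mu]_x (entropy_fun (Num.max (g x) 0))%:E <=
    (K1 + K1)%:E * I)%E.
  rewrite (integral_split_at mu m mmax); last by move=> x; exact: entropy_fun_ge0.
  rewrite gm0 maxxx entropy_fun0 mul0e adde0.
  rewrite EFinD ge0_muleDl ?lee_fin ?(ltW K1_gt0) //.
  apply: leeD; first exact: pos_right.
  apply: le_trans pos_left.
  rewrite le_eqVlt; apply/orP; left; apply/eqP.
  by apply: eq_integral => x _; rewrite /g' opprK.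
clear slope pos_left pos_right IE.
have total : (\int[mu]_x (entropy_fun (g x))%:E <= K%:E * I)%E.
  have -> : (\int[mu]_x (entropy_fun (g x))%:E =
      \int[mu]_x ((entropy_fun (Num.max (g x) 0))%:E +
                  (entropy_fun (Num.min (g x) 0))%:E))%E.
    apply: eq_integral => x _; rewrite -EFinD; congr EFin.
    by have [gx|gx] := leP (g x) 0; rewrite entropy_fun0 ?add0r ?addr0.
  rewrite ge0_integralD //; last 4 first.
  - by move=> x _; rewrite lee_fin entropy_fun_ge0.
  - exact: (measurable_EFin_comp mmax).
  - by move=> x _; rewrite lee_fin entropy_fun_ge0.
  - exact: (measurable_EFin_comp mmin).
  apply: (le_trans (leeD pos neg)).
  have K11 : 0 <= K1 + K1 by lra.
  have K2M : 0 <= K2 * 2 * M by rewrite !mulr_ge0 // ltW.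
  rewrite -ge0_muleDl ?lee_fin //.
  by rewrite -EFinD lee_wpmul2r // lee_fin /K; lra.
clear neg pos.
apply: (le_trans (Ent_le_entropy_fun Delta_exp_moment mphi L0 hL (phi m))).
apply: (@le_trans _ _ ((expR (phi m))%:E * (K%:E * I))%E).
  by apply: lee_wpmul2l total; rewrite lee_fin expR_ge0.
clear total.
rewrite /I -ge0_integralZl_EFin //; last 3 first.
- by move=> x _; rewrite lee_fin.
- exact: (measurable_EFin_comp mF).
- lra.
rewrite -ge0_integralZl_EFin ?expR_ge0 //; last 2 first.
- by move=> x _; rewrite -EFinM lee_fin mulr_ge0 //; lra.
- by apply: (emeasurable_funM (f := cst _)) => //; exact: (measurable_EFin_comp mF).
apply: ge0_le_integral => //.
- move=> x _; rewrite -!EFinM lee_fin !mulr_ge0 ?expR_ge0 //; lra.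
- apply: (emeasurable_funM (f := cst _)) => //.
  by apply: (emeasurable_funM (f := cst _)) => //; exact: (measurable_EFin_comp mF).
- apply/measurable_EFinP; apply: measurable_funM.
    have mm : measurable_fun setT (fun x => K * C * derive1 phi x).
      exact: measurable_funM.
    exact: (measurableT_comp mH mm).
  exact: (measurableT_comp (@measurable_expR R) mphi).
move=> x _; rewrite -!EFinM lee_fin /F /g.
rewrite (_ : expR (phi m) * _ =
    K * H (C * derive1 phi x) * expR (phi m + (phi x - phi m))); last first.
  by rewrite (expRD (phi m)); ring.
rewrite [phi m + _]addrC subrK ler_wpM2r ?expR_ge0 // -mulrA.
exact: (cost_mulr_ge H_convex t0_gt0 H_near0).
Qed.

End DeltaToEntropy.

(** * A smooth convex test function *)

Section FlatFunctions.
Context {R : realType}.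
Implicit Types (p : {poly R}) (x y : R).

Lemma is_derive0_quadratic (f : R -> R) (C : R) : 
  (forall h, `|h| <= 1 -> `|f h| <= C * h ^+ 2) -> is_derive (0 : R) 1 f 0.
Proof.
move=> fC.
have f0 : f 0 = 0.
  have := fC 0; rewrite normr0 expr0n mulr0 => /(_ ler01).
  by rewrite normr_le0 => /eqP.
have lim : h^-1 *: ((f \o shift 0) (h *: (1 : R)) - f 0) @[h --> 0^'] --> (0 : R).
  apply/cvgrPdist_le => e e0.
  have C0 : 0 <= `|C| + 1 by rewrite addr_ge0.
  have d0 : 0 < Num.min 1 (e / (`|C| + 1)).
    by rewrite lt_min ltr01 divr_gt0 // ltr_wpDl.
  near=> h.
  have hN0 : h != 0 by near: h; exact: nbhs_dnbhs_neq.
  have : `|h| < Num.min 1 (e / (`|C| + 1)).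
    near: h; apply: dnbhs0_lt; exact: d0.
  rewrite lt_min => /andP[h1 he].
  rewrite sub0r normrN /= f0 subr0 addr0 [_ *: 1]mulr1 normrM normfV.
  have ah : 0 < `|h| by rewrite normr_gt0.
  rewrite ler_pdivrMl //; apply: (le_trans (fC _ (ltW h1))).
  rewrite ltr_pdivlMr ?ltr_wpDl // in he.
  have : C * h ^+ 2 <= `|C| * h ^+ 2 by rewrite ler_wpM2r ?sqr_ge0 // ler_norm.
  move=> /le_trans; apply; rewrite -(real_normK (num_real h)).
  have := normr_ge0 C; nra.
have d0 : derivable f 0 1 by apply/cvg_ex; exists 0.
by split => //; exact: cvg_lim.
Unshelve. all: by end_near. Qed.

Lemma is_derive1E (f : R -> R) x (d : R) : is_derive x 1 f d -> derive1 f x = d.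
Proof. by move=> [_ <-]; exact: derive1E. Qed.

Definition flat p x := if 0 < x then p.[x^-1] * expR (- x^-1) else 0.

Lemma horner_le_expR p : exists2 C, 0 <= C &
  forall t, 1 <= t -> `|p.[t]| * t ^+ 2 <= C * expR t.
Proof.
pose S := \sum_(i < size p) `|p`_i|.
have S0 : 0 <= S by exact: sumr_ge0.
exists (S * (size p).+2`!%:R); first by rewrite mulr_ge0.
move=> t t1; have t0 : 0 <= t by lra.
have pS : `|p.[t]| <= S * t ^+ size p.
  rewrite horner_coef; apply: (le_trans (ler_norm_sum _ _ _)).
  rewrite mulr_suml; apply: ler_sum => i _.
  rewrite normrM ler_wpM2l // ger0_norm ?exprn_ge0 //.
  by apply: ler_weXn2l => //; exact: ltnW.
apply: (@le_trans _ _ (S * t ^+ size p * t ^+ 2)).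
  by rewrite ler_wpM2r // exprn_ge0.
rewrite -!mulrA ler_wpM2l // -exprD addn2.
have := expR_ge1Dxn (size p).+1 t0 => h.
have f0 : (0 : R) < (size p).+2`!%:R by rewrite ltr0n fact_gt0.
rewrite mulrC -ler_pdivrMr //; lra.
Qed.

Lemma flat_quadratic p : exists C, forall h, `|h| <= 1 ->
  `|flat p h| <= C * h ^+ 2.
Proof.
have [C C0 hC] := horner_le_expR p; exists C => h; rewrite /flat.
case: ifPn => [h0|_]; last by rewrite normr0 mulr_ge0 ?sqr_ge0.
rewrite (ger0_norm (ltW h0)) => h1.
have t1 : 1 <= h^-1 by rewrite invf_ge1.
have := hC _ t1; rewrite normrM (ger0_norm (expR_ge0 _)) expRN.
have e0 := expR_gt0 h^-1; have h2 : 0 < h ^+ 2 by rewrite exprn_gt0.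
rewrite exprVn ler_pdivrMr // => le1.
by rewrite ler_pdivrMr // mulrAC.
Qed.

Lemma is_derive_flat_pos p x : 0 < x ->
  is_derive x 1 (fun y => p.[y^-1] * expR (- y^-1))
    (('X^2 * (p - p^`())).[x^-1] * expR (- x^-1)).
Proof.
move=> x0; have xN0 : x != 0 by rewrite gt_eqF.
have dV : is_derive x (1 : R) (fun y => y^-1) (- x ^- 2).
  apply: (is_derive_eq (is_deriveV (f := id) xN0 _)).
  by rewrite -[RHS]mulr1.
have dp : is_derive x 1 (fun y => p.[y^-1]) (p^`().[x^-1] * - x ^- 2).
  exact: (is_derive1_comp (f := horner p)).
have de : is_derive x 1 (fun y => expR (- y^-1)) (expR (- x^-1) * x ^- 2).
  have dN : is_derive x (1 : R) (fun y : R => - y^-1) (x ^- 2).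
    by apply: (is_derive_eq (is_deriveN dV)); rewrite opprK.
  exact: (is_derive1_comp (f := expR)).
apply: (is_derive_eq (is_deriveM dp de)).
rewrite !hornerE /= -![_ *: _]/(_ * _) exprVn; ring.
Qed.

(** Away from 0 differentiability is local; at 0 the quadratic bound forces derivative 0. *)
Lemma is_derive_positive_part (f g : R -> R) (df : R) x C :
  (forall y, 0 < y -> f y = g y) -> (forall y, y <= 0 -> f y = 0) ->
  (forall h, `|h| <= 1 -> `|f h| <= C * h ^+ 2) ->
  (0 < x -> is_derive x 1 g df) ->
  is_derive x 1 f (if 0 < x then df else 0).
Proof.
move=> fg f0 fC dg; case: ifPn => [x0|].
  apply: near_eq_is_derive (dg x0).
  have : \forall y \near x, 0 < y by exact: lt_nbhsr.
  by apply: filterS => y /fg.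
rewrite -leNgt le_eqVlt => /orP[/eqP ->|x0].
  exact: is_derive0_quadratic fC.
apply: near_eq_is_derive (is_derive_cst (0 : R) x 1).
have : \forall y \near x, y < 0 by exact: lt_nbhsl.
by apply: filterS => y /ltW/f0.
Qed.

Lemma is_derive_flat p x : is_derive x 1 (flat p) (flat ('X^2 * (p - p^`())) x).
Proof.
have [C hC] := flat_quadratic p; rewrite [X in is_derive _ _ _ X]/flat.
apply: is_derive_positive_part hC (@is_derive_flat_pos p x).
  by move=> y y0; rewrite /flat y0.
by move=> y y0; rewrite /flat ltNge y0.
Qed.

(* [x * exp (- 1 / x)] for [x > 0] is convex with derivative
   [(1 + 1 / x) exp (- 1 / x)] in [0, 1], and glues smoothly with 0. *)
Definition soft_pos x := if 0 < x then x * expR (- x^-1) else 0.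

Definition dsoft_pos x := flat (1 + 'X) x.

Lemma is_derive_soft_pos x : is_derive x 1 soft_pos (dsoft_pos x).
Proof.
rewrite /dsoft_pos /flat.
apply: (@is_derive_positive_part _ (fun y => y * expR (- y^-1)) _ _ 1).
- by move=> y y0; rewrite /soft_pos y0.
- by move=> y y0; rewrite /soft_pos ltNge y0.
- move=> h _; rewrite /soft_pos mul1r; case: ifPn => [h0|_]; last first.
    by rewrite normr0 sqr_ge0.
  rewrite normrM (ger0_norm (expR_ge0 _)) (ger0_norm (ltW h0)) expr2.
  rewrite ler_wpM2l ?(ltW h0) // expRN -[leRHS]invrK lef_pV2 ?posrE ?expR_gt0 //.
    by have := expR_ge1Dx h^-1; lra.
  by rewrite invr_gt0.
- move=> x0; have xN0 : x != 0 by rewrite gt_eqF.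
  have de := is_derive_flat_pos 1 x0.
  have -> : (fun y => y * expR (- y^-1)) =
      id \* (fun y => (1 : {poly R}).[y^-1] * expR (- y^-1)).
    by apply/funext => y /=; rewrite hornerC mul1r.
  apply: (is_derive_eq (is_deriveM (is_derive_id x 1) de)).
  have d1 : (1 : {poly R})^`() = 0 by rewrite -polyC1 derivC.
  rewrite d1 subr0 !hornerE -![_ *: _]/(_ * _).
  by field.
Qed.

Lemma smooth_flat p : smooth (flat p).
Proof.
have d q : derive1 (flat q) = flat ('X^2 * (q - q^`())).
  by apply/funext => x; exact: is_derive1E (is_derive_flat q x).
move=> n; suff [q ->] : exists q, derive1n n (flat p) = flat q.
  by move=> x; have [] := is_derive_flat q x.
elim: n => [|n [q qE]]; first by exists p.
by exists ('X^2 * (q - q^`())); rewrite /derive1n /= -/(derive1n n _) qE d.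
Qed.

Lemma smooth_derive1 (f : R -> R) : (forall x, derivable f x 1) ->
  smooth (derive1 f) -> smooth f.
Proof.
move=> df sdf [//|n] x; rewrite /derive1n iterSr; exact: sdf.
Qed.

Lemma derive1_soft_pos : derive1 soft_pos = dsoft_pos.
Proof.
by apply/funext => x; exact: is_derive1E (is_derive_soft_pos x).
Qed.

Lemma smooth_soft_pos : smooth soft_pos.
Proof.
apply: smooth_derive1 => [x|]; first by have [] := is_derive_soft_pos x.
by rewrite derive1_soft_pos; exact: smooth_flat.
Qed.

Lemma smooth_affine (f : R -> R) (a s b : R) : smooth f ->
  smooth (fun x => a * f (s * x + b)).
Proof.
move=> sf.
have d n (c : R) x : is_derive x (1 : R) (fun x => c * derive1n n f (s * x + b))
    (c * s * derive1n n.+1 f (s * x + b)).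
  have dl : is_derive x (1 : R) (fun x : R => s * x + b) s.
    apply: (is_derive_eq (is_deriveD (is_deriveZ s (is_derive_id x 1))
      (is_derive_cst b x 1))).
    by rewrite addr0 -[LHS]/(_ * _) mulr1.
  have df : is_derive (s * x + b) (1 : R) (derive1n n f)
      (derive1n n.+1 f (s * x + b)).
    have -> : derive1n n.+1 f (s * x + b) = derive1 (derive1n n f) (s * x + b).
      by [].
    by rewrite derive1E; apply: DeriveDef; [exact: sf|].
  have dc : is_derive x (1 : R) (fun x : R => derive1n n f (s * x + b))
      (derive1n n.+1 f (s * x + b) * s).
    exact (@is_derive1_comp R (derive1n n f) (fun x : R => s * x + b) x
      (derive1n n.+1 f (s * x + b)) s df dl).
  apply: (is_derive_eq (is_deriveZ c dc)).
  by rewrite -[LHS]/(_ * _); ring.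
move=> n; suff -> : derive1n n (fun x => a * f (s * x + b)) =
    (fun x => (a * s ^+ n) * derive1n n f (s * x + b)).
  by move=> x; have [] := d n (a * s ^+ n) x.
elim: n => [|n IH]; first by apply/funext => x; rewrite expr0 mulr1.
rewrite {1}/derive1n /= -/(derive1n n _) IH; apply/funext => x.
by rewrite (is_derive1E (d n _ x)) exprSr mulrA.
Qed.

Lemma soft_pos_le0 x : x <= 0 -> soft_pos x = 0.
Proof. by move=> x0; rewrite /soft_pos ltNge x0. Qed.

Lemma dsoft_pos_le0 x : x <= 0 -> dsoft_pos x = 0.
Proof. by move=> x0; rewrite /dsoft_pos /flat ltNge x0. Qed.

Lemma soft_pos_ge0 x : 0 <= soft_pos x.
Proof.
by rewrite /soft_pos; case: ifPn => // x0; rewrite mulr_ge0 ?expR_ge0 // ltW.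
Qed.

Lemma dsoft_pos_bound x : 0 <= dsoft_pos x <= 1.
Proof.
rewrite /dsoft_pos /flat; case: ifPn => [x0|_]; last by rewrite lexx ler01.
have i0 : 0 < x^-1 by rewrite invr_gt0.
have e0 := expR_gt0 x^-1; have := expR_ge1Dx x^-1.
rewrite !hornerE expRN ler_pdivrMr // mul1r => ->.
by rewrite divr_ge0 ?(ltW e0) //; lra.
Qed.

(** Smoothing costs at most 1 in height, the origin of the [d - 1] in [dual_bound]. *)
Lemma soft_pos_ge x : x - 1 <= soft_pos x.
Proof.
rewrite /soft_pos; case: ifPn => [x0|]; last by rewrite -leNgt; lra.
have := expR_ge1Dx (- x^-1); rewrite -(ler_pM2l x0) mulrDr mulr1 mulrN.
by rewrite divff ?gt_eqF.
Qed.

(* For [x, y > 0] this is [1 + (1/x - 1/y) <= exp (1/x - 1/y)]. *)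
Lemma soft_pos_tangent x y : soft_pos x + dsoft_pos x * (y - x) <= soft_pos y.
Proof.
have [x0|x0] := leP x 0.
  by rewrite soft_pos_le0 // dsoft_pos_le0 // mul0r addr0 soft_pos_ge0.
have xN0 : x != 0 by rewrite gt_eqF.
have ex := expR_gt0 (- x^-1).
have -> : soft_pos x + dsoft_pos x * (y - x) =
    expR (- x^-1) * (y + y / x - 1).
  by rewrite /soft_pos /dsoft_pos /flat x0 !hornerE; field.
have [y0|y0] := leP y 0.
  rewrite soft_pos_le0 // pmulr_rle0 //.
  have : y / x <= 0 by rewrite pmulr_lle0 // invr_gt0.
  by lra.
have yN0 : y != 0 by rewrite gt_eqF.
rewrite /soft_pos y0 (_ : - y^-1 = - x^-1 + (x^-1 - y^-1)); last by ring.
rewrite expRD mulrCA ler_wpM2l ?(ltW ex) //.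
have := expR_ge1Dx (x^-1 - y^-1); rewrite -(ler_pM2l y0); apply: le_trans.
by rewrite le_eqVlt; apply/orP; left; apply/eqP; field; rewrite xN0 yN0.
Qed.

Lemma tangent_convex (f df : R -> R) :
  (forall x y, f x + df x * (y - x) <= f y) -> convex_fun f.
Proof.
move=> tg x y t t_ge0 t_le1; set z := t * x + (1 - t) * y.
have h1 : t * (f z + df z * (x - z)) <= t * f x by rewrite ler_wpM2l.
have h2 : (1 - t) * (f z + df z * (y - z)) <= (1 - t) * f y.
  by rewrite ler_wpM2l // subr_ge0.
apply: le_trans (lerD h1 h2); rewrite le_eqVlt; apply/orP; left; apply/eqP.
by rewrite /z; ring.
Qed.

Lemma tangent_bounded_lipschitz (f df : R -> R) (L : R) :
  (forall x y, f x + df x * (y - x) <= f y) -> (forall x, `|df x| <= L) ->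
  forall x y, `|f x - f y| <= L * `|x - y|.
Proof.
move=> tg dL.
have half x y : f x - f y <= L * `|x - y|.
  apply: (@le_trans _ _ (df x * (x - y))); first by have := tg x y; lra.
  apply: (le_trans (ler_norm _)); rewrite normrM ler_wpM2r //.
move=> x y; have h1 := half x y; have h2 := half y x.
by rewrite ler_norml h1 andbT lerNl opprB distrC.
Qed.

Lemma lipschitz_of_bound (f : R -> R) (L : R) :
  (forall x y, `|f x - f y| <= L * `|x - y|) -> lipschitz f.
Proof.
move=> fL; exists L; split; first exact: num_real.
move=> M LM [x y] _ /=; apply: (le_trans (fL x y)).
by rewrite ler_wpM2r // ltW.
Qed.

End FlatFunctions.

(** * Laplace transforms and entropy *)

Section LinearCombination.
Context {R : realType} (mu : probability R R).

(** Lets each comparison of Laplace transforms below reduce to one pointwise inequality. *)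
Lemma Rintegral_comb_ge0 (f1 f2 f3 f4 : R -> R) (a1 a2 a3 a4 : R) :
  mu.-integrable setT (EFin \o f1) -> mu.-integrable setT (EFin \o f2) ->
  mu.-integrable setT (EFin \o f3) -> mu.-integrable setT (EFin \o f4) ->
  (forall x, 0 <= a1 * f1 x + a2 * f2 x + (a3 * f3 x + a4 * f4 x)) ->
  0 <= a1 * (\int[mu]_x f1 x) + a2 * (\int[mu]_x f2 x) +
       (a3 * (\int[mu]_x f3 x) + a4 * (\int[mu]_x f4 x)).
Proof.
move=> I1 I2 I3 I4 comb.
have Z f a : mu.-integrable setT (EFin \o f) ->
    mu.-integrable setT (EFin \o (fun x => a * f x)).
  by move=> If; exact: (@integrableZl _ _ _ mu setT measurableT a _ If).
have J1 := Z _ a1 I1; have J2 := Z _ a2 I2; have J3 := Z _ a3 I3.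
have J4 := Z _ a4 I4.
have J12 : mu.-integrable setT (EFin \o (fun x => a1 * f1 x + a2 * f2 x)).
  exact: (integrableD measurableT J1 J2).
have J34 : mu.-integrable setT (EFin \o (fun x => a3 * f3 x + a4 * f4 x)).
  exact: (integrableD measurableT J3 J4).
rewrite -(RintegralZl _ measurableT I1) -(RintegralZl _ measurableT I2).
rewrite -(RintegralZl _ measurableT I3) -(RintegralZl _ measurableT I4).
rewrite -(RintegralD measurableT J1 J2) -(RintegralD measurableT J3 J4).
by rewrite -(RintegralD measurableT J12 J34); apply: Rintegral_ge0.
Qed.

Lemma Rintegral_indic (B : set R) : measurable B ->
  \int[mu]_x (\1_B x : R) = fine (mu B).
Proof. by move=> mB; rewrite /Rintegral integral_indic // setIT. Qed.

Lemma integrable_indicR (B : set R) : measurable B ->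
  mu.-integrable setT (EFin \o (\1_B : R -> R)).
Proof.
move=> mB; apply: integrable_indic => //.
Qed.

End LinearCombination.

Section EntropyEstimates.
Context {R : realType}.
Implicit Types p J T e : R.

Lemma xlnx_tangent (J t : R) : 0 < J -> 0 < t -> t + t * ln J - J <= t * ln t.
Proof.
move=> J0 t0; have Jt : 0 < J / t by rewrite divr_gt0.
have := expR_ge1Dx (ln (J / t)); rewrite lnK ?posrE // ln_div ?posrE // => h.
have := h; rewrite -(ler_pM2l t0) mulrCA divff ?gt_eqF // mulr1; lra.
Qed.

(* Jensen's inequality for [t * ln t] at the points 1 and [(J - (1 - p)) / p],
   with weights [1 - p] and [p]. *)
Lemma xlnx_half_jensen p J : 0 < p -> p <= 2^-1 -> p <= J - (1 - p) ->
  J * ln J <= (J - (1 - p)) * ln ((J - (1 - p)) / p).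
Proof.
move=> p0 p1; set K := J - (1 - p) => pK; have K0 : 0 < K by lra.
have r0 : 0 < K / p by rewrite divr_gt0.
have J0 : 0 < J by rewrite /K in pK; lra.
have h1 := xlnx_tangent J0 (ltr01 : (0 : R) < 1); rewrite ln1 mul1r mulr0 in h1.
have h2 := xlnx_tangent J0 r0.
have {}h1 : (1 - p) * (1 + ln J - J) <= (1 - p) * 0 by rewrite ler_wpM2l //; lra.
have {}h2 := ler_wpM2l (ltW p0) h2.
have pKK : p * (K / p) = K by rewrite mulrCA divff ?mulr1 // gt_eqF.
have e1 : p * (K / p + K / p * ln J - J) = K + K * ln J - p * J.
  by rewrite -[in RHS]pKK; ring.
have e2 : p * (K / p * ln (K / p)) = K * ln (K / p) by rewrite mulrA pKK.
rewrite e1 e2 in h2.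
have : (1 - p) * (1 + ln J - J) + (K + K * ln J - p * J) = J * ln J.
  by rewrite /K; ring.
by move: h1; rewrite mulr0; lra.
Qed.

(** A derivative-free Herbst argument. With [K = J - (1 - p)], the choice [a = T / (2 * K)] in the
    third-to-last condition gives [ln (K / p) - a <= ln (K2 / p)], while Jensen and the entropy
    bound give [2 * a <= ln (K / p) + e]; eliminating [a] gives the claim. *)
Lemma entropy_doubling p J T K2 e : 0 < p -> p <= 2^-1 ->
  p <= J - (1 - p) -> p <= K2 ->
  (forall a, expR (- a) * ((1 + a) * (J - (1 - p)) - T / 2) <= K2) ->
  T - J * ln J <= e * (J - (1 - p)) ->
  ln ((J - (1 - p)) / p) <= 2 * ln (K2 / p) + e.
Proof.
move=> p0 p1 pK pK2 half LS; have jensen := xlnx_half_jensen p0 p1 pK.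
move: (J - (1 - p)) pK half LS jensen => K pK half LS jensen.
have K0 : 0 < K by lra.
pose a := T / (2 * K); have {}half := half a.
rewrite (_ : (1 + a) * K - T / 2 = K) in half; last first.
  by rewrite /a; field; rewrite gt_eqF.
have le_ln : ln (K / p) - a <= ln (K2 / p).
  rewrite -ler_expR expRD !lnK ?posrE ?divr_gt0 //; last by lra.
  by rewrite mulrAC ler_wpM2r ?invr_ge0 ?(ltW p0) // mulrC.
have : 2 * a <= ln (K / p) + e.
  rewrite (_ : 2 * a = T / K); last by rewrite /a; field; rewrite gt_eqF.
  by rewrite ler_pdivrMr //; lra.
by lra.
Qed.

(* [Ent (g ^ 2) >= E (g ^ 2) - (E g) ^ 2], with [J = E (g ^ 2)], [J2 = E g] and
   [T = E (g ^ 2 * ln (g ^ 2))]. *)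
Lemma entropy_ge_variance J J2 T : 0 < J -> 0 <= J2 ->
  (forall a, expR (- a) * ((1 + a) * J - T / 2) <= J2) ->
  J - J2 ^+ 2 <= T - J * ln J.
Proof.
move=> J0 J2_ge0 half; pose a := T / (2 * J); have {}half := half a.
rewrite (_ : (1 + a) * J - T / 2 = J) in half; last first.
  by rewrite /a; field; rewrite gt_eqF.
have e0 : 0 <= expR (- a) * J by rewrite mulr_ge0 ?expR_ge0 // ltW.
have sq : (expR (- a) * J) ^+ 2 <= J2 ^+ 2 by rewrite ler_sqr ?nnegrE.
have ea : expR (- a) ^+ 2 = expR (- (T / J)).
  by rewrite -expRM_natl; congr expR; rewrite /a; field; rewrite gt_eqF.
have {}ea : (expR (- a) * J) ^+ 2 = J * expR (ln J - T / J).
  by rewrite expRD lnK ?posrE // exprMn ea; ring.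
have := expR_ge1Dx (ln J - T / J); rewrite -(ler_pM2l J0) -ea.
rewrite (_ : J * (1 + (ln J - T / J)) = J + J * ln J - T); first by lra.
by field; rewrite gt_eqF.
Qed.

(** Put [rho ^ 2 = (J - (1 - p)) / p]. Cauchy-Schwarz, given as a family in [r] and used at
    [r = rho], bounds the variance below by [(p / 2) * (rho - 1)^2]. Against [e <= 1/8] this forces
    [rho - 1 <= rho / 2], so [rho <= 2]. *)
Lemma entropy_small p J J2 T e : 0 < p -> p <= 2^-1 ->
  p <= J - (1 - p) -> 0 <= J2 ->
  (forall a, expR (- a) * ((1 + a) * J - T / 2) <= J2) ->
  (forall r, 0 < r -> J2 - (1 - p) <= ((J - (1 - p)) / r + r * p) / 2) ->
  T - J * ln J <= e * (J - (1 - p)) -> e <= 8^-1 ->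
  ln ((J - (1 - p)) / p) <= 2.
Proof.
move=> p0 p1 pK J2_ge0 half cs LS e8; have J0 : 0 < J by lra.
have ent := entropy_ge_variance J0 J2_ge0 half.
pose rho := Num.sqrt ((J - (1 - p)) / p).
have r1 : 1 <= (J - (1 - p)) / p by rewrite ler_pdivlMr // mul1r.
have rho1 : 1 <= rho by rewrite -sqrtr1 ler_wsqrtr.
have rho2 : rho ^+ 2 = (J - (1 - p)) / p by rewrite sqr_sqrtr //; lra.
rewrite -rho2; have KE : J - (1 - p) = p * rho ^+ 2.
  by rewrite rho2; field; rewrite gt_eqF.
move: (rho) rho1 KE => r r_ge1 KE {rho rho2 r1}; rewrite KE in LS cs.
have r0 : 0 < r by lra.
have {cs} : J2 - (1 - p) <= p * r.
  by have := cs r r0; rewrite (_ : (_ / r + _) / 2 = p * r) //; field; rewrite gt_eqF.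
move=> J2_le.
have h2 : J2 ^+ 2 <= (1 - p + p * r) ^+ 2.
  have pr : 0 <= p * r by rewrite mulr_ge0 // ltW.
  by rewrite ler_sqr ?nnegrE //; lra.
have h1 : e * (p * r ^+ 2) <= 8^-1 * (p * r ^+ 2).
  by rewrite ler_wpM2r // mulr_ge0 ?sqr_ge0 // ltW.
have h3 : (1 - p + p * r ^+ 2) - (1 - p + p * r) ^+ 2 =
    p * (1 - p) * (r - 1) ^+ 2 by ring.
have h4 : p / 2 * (r - 1) ^+ 2 <= p * (1 - p) * (r - 1) ^+ 2.
  by rewrite ler_wpM2r ?sqr_ge0 // ler_wpM2l ?(ltW p0) //; lra.
have main : p * (r - 1) ^+ 2 <= p * (r / 2) ^+ 2.
  rewrite (_ : (r / 2) ^+ 2 = 4^-1 * r ^+ 2); last by field.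
  by lra.
have r_le : r <= 2.
  by move: main; rewrite ler_pM2l // ler_sqr ?nnegrE; lra.
rewrite -ler_expR lnK ?posrE ?exprn_gt0 //.
have e1 := expR_ge1Dx (1 : R).
have -> : expR 2 = expR 1 ^+ 2 :> R by rewrite -expRM_natl mulr1.
by rewrite ler_sqr ?nnegrE ?expR_ge0 //; lra.
Qed.

Lemma doubling_iter (v h : R -> R) n (l : R) :
  (forall l, 0 < l -> v l <= 2 * v (l / 2) + h l) -> 0 < l ->
  v l <= 2 ^+ n * v (l / 2 ^+ n) + \sum_(i < n) 2 ^+ i * h (l / 2 ^+ i).
Proof.
move=> vh l0; elim: n => [|n IH].
  by rewrite big_ord0 !expr0 mul1r divr1 addr0.
apply: (le_trans IH); rewrite big_ord_recr /= [leLHS]addrC [leRHS]addrCA lerD2l.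
have t0 : (0 : R) < 2 ^+ n by rewrite exprn_gt0.
have ln0 : 0 < l / 2 ^+ n by rewrite divr_gt0.
have := vh _ ln0; rewrite -(ler_pM2l t0).
rewrite (_ : l / 2 ^+ n / 2 = l / 2 ^+ n.+1); last by rewrite exprSr invfM mulrA.
by rewrite mulrDr mulrA -exprSr.
Qed.

End EntropyEstimates.

(** * Laplace transform of a function supported on a tail *)

Section Herbst.
Context {R : realType} (mu : probability R R) (Z : R -> R) (B : set R).
Hypothesis exp_moment :
  forall s : R, 0 < s -> (\int[mu]_x (expR (s * `|x|))%:E < +oo)%E.
Hypothesis Z_ge0 : forall x, 0 <= Z x.
Hypothesis Z_lip : forall x y, `|Z x - Z y| <= `|x - y|.
Hypothesis mZ : measurable_fun setT Z.
Hypothesis mB : measurable B.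
Hypothesis Z_off : forall x, ~ B x -> Z x = 0.

Let p := fine (mu B).
Definition laplace (l : R) := \int[mu]_x expR (l * Z x).
Definition laplace_deriv (l : R) := \int[mu]_x (expR (l * Z x) * (l * Z x)).

Let mlZ (l : R) : measurable_fun setT (fun x => l * Z x).
Proof. exact: measurable_funM. Qed.

Let lZ_lip (l x y : R) : 0 < l -> `|l * Z x - l * Z y| <= l * `|x - y|.
Proof.
by move=> l0; rewrite -mulrBr normrM (gtr0_norm l0) ler_wpM2l ?Z_lip // ltW.
Qed.

Let I1 (l : R) : 0 < l -> mu.-integrable setT (EFin \o (fun x => expR (l * Z x))).
Proof.
by move=> l0; apply: (integrable_expR_lipschitz exp_moment (mlZ l) l0) => x y;
  exact: lZ_lip.
Qed.

Let I2 (l : R) : 0 < l ->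
  mu.-integrable setT (EFin \o (fun x => expR (l * Z x) * (l * Z x))).
Proof.
by move=> l0; apply: (integrable_expRM_lipschitz exp_moment (mlZ l) l0) => x y;
  exact: lZ_lip.
Qed.

Lemma Ent_laplace (l : R) : 0 < l -> Ent mu (fun x => expR (l * Z x)) =
  (laplace_deriv l - laplace l * ln (laplace l))%:E.
Proof.
by move=> l0; apply: (EntE exp_moment (mlZ l) l0) => x y; exact: lZ_lip.
Qed.

Let mBC : measurable (~` B). Proof. exact: measurableC. Qed.
Let IB := integrable_indicR mu mBC.

Let EB : \int[mu]_x (\1_(~` B) x : R) = 1 - p.
Proof.
rewrite Rintegral_indic // probability_setC // probability_fin //.
Qed.

Let offB (x : R) : (\1_(~` B) x = 0 :> R) \/ (\1_(~` B) x = 1 :> R /\ Z x = 0).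
Proof.
rewrite indicE; case: (boolP (x \in ~` B)) => xB; last by left.
by right; split => //; apply: Z_off; rewrite inE in xB.
Qed.

(** Pointwise, with [v = l * Z x], this is [exp (v / 2) >= exp (- a) * exp v * (1 + a - v / 2)]; off
    B it reduces to [exp (- a) * (1 + a) <= 1]. The value [th = 1] removes the mass off B (doubling
    step), [th = 0] keeps it (variance step). *)
Lemma laplace_half (th a l : R) : 0 < l -> th <= 1 ->
  expR (- a) * ((1 + a) * (laplace l - th * (1 - p)) - laplace_deriv l / 2) <=
  laplace (l / 2) - th * (1 - p).
Proof.
move=> l0 th1; have l2 : 0 < l / 2 by lra.
have := @Rintegral_comb_ge0 R mu _ _ _ _
  1 (- (expR (- a) * (1 + a))) (expR (- a) / 2)
  (- (1 - expR (- a) * (1 + a)) * th) (I1 l2) (I1 l0) (I2 l0) IB.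
rewrite EB -/(laplace _) -/(laplace _) -/(laplace_deriv _) => h.
suff h' : forall x, 0 <= 1 * expR (l / 2 * Z x) +
    - (expR (- a) * (1 + a)) * expR (l * Z x) +
    (expR (- a) / 2 * (expR (l * Z x) * (l * Z x)) +
     - (1 - expR (- a) * (1 + a)) * th * \1_(~` B) x).
  by have := h h'; lra.
move=> x {h}; have ea := expR_gt0 (- a).
have ea1 : expR (- a) * (1 + a) <= 1.
  have := expR_ge1Dx a; rewrite -(ler_pM2l ea) expRN mulVf //.
  by rewrite gt_eqF // expR_gt0.
have [->|[-> ->]] := offB x; last first.
  by rewrite !mulr0 expR0; nra.
have eu := expR_gt0 (l * Z x).
have : expR (- a) * expR (l * Z x) * (1 + (a - l * Z x / 2)) <= expR (l / 2 * Z x).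
  have -> : expR (l / 2 * Z x) = expR (- a) * expR (l * Z x) * expR (a - l * Z x / 2).
    by rewrite -!expRD; congr expR; field.
  by rewrite ler_wpM2l ?expR_ge1Dx // mulr_ge0 // ltW.
by lra.
Qed.

Lemma laplace_half_le (rho l : R) : 0 < l -> 0 < rho ->
  laplace (l / 2) - (1 - p) <= ((laplace l - (1 - p)) / rho + rho * p) / 2.
Proof.
move=> l0 r0; have l2 : 0 < l / 2 by lra.
have I0 : mu.-integrable setT (EFin \o (fun _ : R => (1 : R))).
  exact: finite_measure_integrable_cst.
have E1 : \int[mu]_x (1 : R) = 1.
  rewrite Rintegral_cst // mul1r -[RHS]/(fine 1%E); congr fine.
  exact: probability_setT.
have := @Rintegral_comb_ge0 R mu _ _ _ _
  (- 1) (rho^-1 / 2) (rho / 2) (1 - rho^-1 / 2 - rho / 2) (I1 l2) (I1 l0) I0 IB.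
rewrite EB E1 -/(laplace _) -/(laplace _) => h.
suff h' : forall x, 0 <= - 1 * expR (l / 2 * Z x) +
    rho^-1 / 2 * expR (l * Z x) + (rho / 2 * 1 +
    (1 - rho^-1 / 2 - rho / 2) * \1_(~` B) x) by have := h h'; lra.
move=> x {h}; have [->|[-> ->]] := offB x; last first.
  by rewrite !mulr0 expR0; lra.
have -> : expR (l * Z x) = expR (l / 2 * Z x) ^+ 2.
  by rewrite -expRM_natl; congr expR; field.
set e := expR _.
have : 0 <= rho^-1 / 2 * (e - rho) ^+ 2.
  by rewrite mulr_ge0 ?sqr_ge0 // divr_ge0 // invr_ge0 ltW.
suff -> : rho^-1 / 2 * (e - rho) ^+ 2 = - 1 * e + rho^-1 / 2 * e ^+ 2 +
    (rho / 2 * 1 + (1 - rho^-1 / 2 - rho / 2) * 0) by [].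
by field; rewrite gt_eqF.
Qed.

Lemma laplace_mono (l l' : R) : 0 < l -> l <= l' -> laplace l <= laplace l'.
Proof.
move=> l0 ll; apply: le_Rintegral => //.
- exact: I1.
- by apply: I1; exact: lt_le_trans ll.
by move=> x _; rewrite ler_expR ler_wpM2r.
Qed.

Lemma laplace_chernoff (S : set R) (v l : R) : measurable S -> 0 < l ->
  (forall x, S x -> B x /\ v <= Z x) ->
  expR (l * v) * fine (mu S) <= laplace l - (1 - p).
Proof.
move=> mS l0 SB; have IS := integrable_indicR mu mS.
have := @Rintegral_comb_ge0 R mu _ _ _ _
  1 (- 1) (- expR (l * v)) 0 (I1 l0) IB IS IS.
rewrite EB Rintegral_indic // -/(laplace _) => h.
suff h' : forall x, 0 <= 1 * expR (l * Z x) + - 1 * \1_(~` B) x +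
    (- expR (l * v) * \1_S x + 0 * \1_S x) by have := h h'; lra.
move=> x {h}; rewrite mul0r addr0 !indicE.
have [xS|xS] := boolP (x \in S).
  rewrite inE in xS; have [xB vZ] := SB _ xS.
  rewrite (_ : (x \in ~` B) = false); last first.
    by apply/negbTE; rewrite notin_setE => /(_ xB).
  have : expR (l * v) <= expR (l * Z x) by rewrite ler_expR ler_wpM2l // ltW.
  by rewrite /= mulr0n mulr1n; lra.
rewrite /= mulr0n mulr0 addr0.
have : 1 <= expR (l * Z x) by rewrite -expR0 ler_expR mulr_ge0 // ltW.
by case: (x \in ~` B); rewrite ?mulr1n ?mulr0n; lra.
Qed.

Lemma laplace_ge1 (l : R) : 0 < l -> 1 <= laplace l.
Proof.
move=> l0; have := @laplace_chernoff B 0 l mB l0 (fun x xB => conj xB (Z_ge0 x)).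
by rewrite mulr0 expR0 mul1r -/p; lra.
Qed.

Variables (H : R -> R) (c : R).
Hypothesis p_gt0 : 0 < p.
Hypothesis p_le : p <= 2^-1.
Hypothesis log_sobolev : forall l : R, 0 < l ->
  laplace_deriv l - laplace l * ln (laplace l) <=
  H (c * l) * (laplace l - (1 - p)).

(** As [Z] vanishes off B, this is the logarithm of the conditional expectation of [expR (l * Z)]
    given B. *)
Definition log_laplace (l : R) := ln ((laplace l - (1 - p)) / p).

Let K_ge (l : R) : 0 < l -> p <= laplace l - (1 - p).
Proof. by move=> /laplace_ge1; lra. Qed.

Lemma log_laplace_half (l : R) : 0 < l ->
  log_laplace l <= 2 * log_laplace (l / 2) + H (c * l).
Proof.
move=> l0; have l2 : 0 < l / 2 by lra.
apply: (entropy_doubling p_gt0 p_le (K_ge l0) (K_ge l2) _ (log_sobolev l0)) => a.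
by have := laplace_half a l0 (lexx 1); rewrite !mul1r.
Qed.

Lemma log_laplace_init (l : R) : 0 < l -> H (c * l) <= 8^-1 ->
  log_laplace l <= 2.
Proof.
move=> l0; have l2 : 0 < l / 2 by lra.
have J2 : 0 <= laplace (l / 2) by apply: le_trans (laplace_ge1 l2).
apply: (entropy_small p_gt0 p_le (K_ge l0) J2 _ _ (log_sobolev l0)) => [a|r r0].
  by have := laplace_half a l0 (ler01 : (0 : R) <= 1); rewrite !mul0r !subr0.
exact: laplace_half_le.
Qed.

Lemma log_laplace_mono (l l' : R) : 0 < l -> l <= l' ->
  log_laplace l <= log_laplace l'.
Proof.
move=> l0 ll; have h := laplace_mono l0 ll.
have d1 := lt_le_trans p_gt0 (K_ge l0).
have d2 := lt_le_trans p_gt0 (K_ge (lt_le_trans l0 ll)).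
have le : (laplace l - (1 - p)) / p <= (laplace l' - (1 - p)) / p.
  apply: ler_wpM2r; first by rewrite invr_ge0 ltW.
  exact: lerB h (lexx _).
rewrite /log_laplace ler_ln; first exact: le.
  by rewrite posrE (divr_gt0 d1 p_gt0).
by rewrite posrE (divr_gt0 d2 p_gt0).
Qed.

End Herbst.

(** * Summing the dyadic costs and dualising *)

Lemma half_powR_bound {R : realType} (alpha : R) : 1 < alpha ->
  0 <= (2^-1 : R) `^ alpha /\ 2 * 2^-1 `^ alpha < 1.
Proof.
move=> a1; split; first exact: powR_ge0.
have l2 : 0 < ln (2 : R) by rewrite ln_gt0 // ltr1n.
have : (2^-1 : R) `^ alpha < 2^-1.
  rewrite /powR gt_eqF ?invr_gt0 // lnV ?posrE //.
  rewrite -[ltRHS]lnK ?posrE ?invr_gt0 // ltr_expR lnV ?posrE //; nra.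
lra.
Qed.

Section EntropyToDelta.
Context {R : realType} (H : R -> R) (t0 A alpha : R).
Hypothesis H_ge0 : forall x, 0 <= H x.
Hypothesis H_even : forall x, H (- x) = H x.
Hypothesis H_convex : convex_fun H.
Hypothesis t0_gt0 : 0 < t0.
Hypothesis H_near0 :
  forall x : R, - (2 * t0) <= x <= 2 * t0 -> H x = 4^-1 * x ^+ 2.
Hypothesis legendre_superlinear :
  (fun x => legendre H x / x) x @[x --> +oo] --> +oo.
Hypothesis A_ge1 : 1 <= A.
Hypothesis alpha_gt1 : 1 < alpha.
Hypothesis H_growth :
  forall x s, 0 <= s <= 1 -> H (s * x) <= A * s `^ alpha * H x.

Let q : R := 2^-1 `^ alpha.

Let q_bound : 0 <= q /\ 2 * q < 1. Proof. exact: half_powR_bound. Qed.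

Let A' : R := A / (1 - 2 * q).

Let A'_ge1 : 1 <= A'.
Proof.
have [q0 q1] := q_bound; have a1 := A_ge1.
by rewrite ler_pdivlMr; lra.
Qed.

(** The growth condition at [s = 2 ^- i] bounds the terms by [A * H x * (2 * q) ^+ i]; the ratio is
    below 1 because [alpha > 1], and [A'] carries the sum of the series. *)
Lemma cost_dyadic_sum n (x : R) :
  \sum_(i < n) 2 ^+ i * H (x / 2 ^+ i) <= A' * H x.
Proof.
have [q0 q1] := q_bound; have a1 := A_ge1.
have dyadic i : 2 ^+ i * H (x / 2 ^+ i) <= (A * H x) * (2 * q) ^+ i.
  have s1 : 0 <= (2 ^+ i : R)^-1 <= 1.
    by rewrite invr_ge0 exprn_ge0 //= invf_le1 ?exprn_gt0 // exprn_ege1 // ler1n.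
  have := H_growth x s1; rewrite mulrC.
  have -> : (2 ^+ i : R)^-1 `^ alpha = q ^+ i.
    rewrite -exprVn -powR_mulrn ?invr_ge0 // -powRrM mulrC powRrM.
    by rewrite powR_mulrn // powR_ge0.
  move=> h; rewrite exprMn.
  have t2 : (0 : R) <= 2 ^+ i by rewrite exprn_ge0.
  apply: (le_trans (ler_wpM2l t2 h)).
  by rewrite le_eqVlt; apply/orP; left; apply/eqP; ring.
apply: (@le_trans _ _ (A * H x * \sum_(i < n) (2 * q) ^+ i)).
  by rewrite mulr_sumr; apply: ler_sum => i _; exact: dyadic.
have hX := subrX1 (2 * q) n.
have q_n : 0 <= (2 * q) ^+ n by rewrite exprn_ge0 // mulr_ge0.
have q1' : 0 < 1 - 2 * q by lra.
rewrite /A' [leRHS]mulrAC ler_pdivlMr //.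
set S := \sum_(i < n) _ in hX *.
have S1 : S * (1 - 2 * q) <= 1 by lra.
have AH : 0 <= A * H x by rewrite mulr_ge0 //; lra.
by have := ler_wpM2l AH S1; rewrite mulr1 mulrA.
Qed.

Lemma pow2_between (r : R) : 0 < r -> exists n, r <= 2 ^+ n <= 1 + 2 * r.
Proof.
move=> r0.
have ex : exists n, r <= 2 ^+ n :> R.
  exists (Num.truncn r).+1; apply: ltW; apply: lt_le_trans (truncnS_gt r) _.
  by rewrite -natrX ler_nat ltnW // ltn_expl.
case: (ex_minnP ex) => -[|n] rn nmin; [exists 0%N|exists n.+1].
  by rewrite rn /= expr0; lra.
have : 2 ^+ n < r by rewrite ltNge; apply/negP => /nmin; rewrite ltnn.
by rewrite rn /= exprS; lra.
Qed.

(** Write [d = 1 + 4 / lam + A' * c * t]. With [y = A' * c * l] and [A' * H (c * l) <= H y], the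
    hypothesis reads [t * y - H y <= h + 2], that is [legendre H t <= h + 2]. Scaling by
    [k = min(1, t0^2 / 2)] turns [h + 2] into at most [t0^2 + h]; [legendre_inv_ge] absorbs
    [1 + 4 / lam]. *)
Lemma dual_bound (c lam d h : R) : 0 < c -> 0 < lam -> 0 < h ->
  (forall l, 0 < l ->
     l * (d - 1) - h <= 2 * (1 + 2 * (l / lam)) + A' * H (c * l)) ->
  d <= ((1 + 4 / lam) * (2 / t0) + A' * c / Num.min 1 (t0 ^+ 2 / 2)) *
       inv_nonneg (legendre H) (t0 ^+ 2 + h).
Proof.
move=> c0 lam0 h0 lin; have a1 := A'_ge1; have t0P := t0_gt0.
have t02 : 0 < t0 ^+ 2 by rewrite exprn_gt0.
have := legendre_inv_ge H_ge0 H_even H_convex t0_gt0 H_near0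
  legendre_superlinear (ltW h0).
set iota := inv_nonneg _ _ => iota_ge.
set k := Num.min 1 _.
have k0 : 0 < k by rewrite lt_min ltr01 /=; lra.
have k1 : k <= 1 by rewrite ge_min lexx.
have k2 : k <= t0 ^+ 2 / 2 by rewrite ge_min lexx orbT.
have Ac : 0 < A' * c by rewrite mulr_gt0 //; lra.
have il : 0 < 4 / lam by rewrite divr_gt0.
have first_term : 1 + 4 / lam <= (1 + 4 / lam) * (2 / t0) * iota.
  rewrite -mulrA -[leLHS]mulr1 ler_wpM2l //; first by lra.
  by rewrite mulrAC ler_pdivlMr //; lra.
pose t := (d - 1 - 4 / lam) / (A' * c).
have dE : d = 1 + 4 / lam + A' * c * t.
  by rewrite /t mulrCA divff ?gt_eqF // mulr1; ring.
have second_term : A' * c * t <= A' * c / k * iota.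
  rewrite [leRHS]mulrAC -[leRHS](mulrA (A' * c)) (ler_wpM2l (ltW Ac)) //.
  rewrite ler_pdivlMr // mulrC.
  have [tneg|tpos] := leP t 0.
    by apply: (@le_trans _ _ 0); [rewrite pmulr_rle0|lra].
  apply: (le_legendre_inv H_ge0 H_even t0_gt0 H_near0 legendre_superlinear).
    by lra.
  apply: le_trans (legendre_scale H_ge0 H_even t0_gt0 H_near0
    legendre_superlinear t (ltW k0) k1) _.
  have : legendre H t <= h + 2.
    apply: (legendre_le H_even legendre_superlinear) => y.
    have [y0|y0] := leP y 0.
      have := H_ge0 y; have : t * y <= 0 by rewrite pmulr_rle0.
      by lra.
    have l0 : 0 < y / (A' * c) by rewrite divr_gt0.
    have := lin _ l0.
    have : A' * H (c * (y / (A' * c))) <= H (A' * (c * (y / (A' * c)))).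
      exact: (cost_mulr_ge H_convex t0_gt0 H_near0).
    rewrite (_ : A' * (c * (y / (A' * c))) = y); last first.
      by rewrite mulrA mulrCA divff ?mulr1 // gt_eqF.
    have : t * y = y / (A' * c) * (d - 1) - 4 * (y / (A' * c) / lam).
      by rewrite /t; field; rewrite !gt_eqF //; lra.
    by lra.
  rewrite -(ler_pM2l k0) => /le_trans; apply.
  by have : k * h <= h; [rewrite ler_piMl // ltW|lra].
by rewrite mulrDl {1}dE; lra.
Qed.

End EntropyToDelta.

(** * From the entropy inequality to the increments of the quantiles *)

Section ConvexLogSobolevToDelta.
Context {R : realType} (H : R -> R) (t0 A alpha : R).
Hypothesis H_ge0 : forall x, 0 <= H x.
Hypothesis H_even : forall x, H (- x) = H x.
Hypothesis H_convex : convex_fun H.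
Hypothesis t0_gt0 : 0 < t0.
Hypothesis H_near0 :
  forall x : R, - (2 * t0) <= x <= 2 * t0 -> H x = 4^-1 * x ^+ 2.
Hypothesis legendre_superlinear :
  (fun x => legendre H x / x) x @[x --> +oo] --> +oo.
Hypothesis A_ge1 : 1 <= A.
Hypothesis alpha_gt1 : 1 < alpha.
Hypothesis H_growth :
  forall x s, 0 <= s <= 1 -> H (s * x) <= A * s `^ alpha * H x.
Variables (mu : probability R R) (c : R).
Hypothesis c_gt0 : 0 < c.
Hypothesis exp_moment :
  forall s : R, 0 < s -> (\int[mu]_x (expR (s * `|x|))%:E < +oo)%E.
Hypothesis log_sobolev :
  forall phi : R -> R, smooth phi -> convex_fun phi -> lipschitz phi ->
    (Ent mu (fun x => expR (phi x))
     <= \int[mu]_x (H (c * derive1 phi x) * expR (phi x))%:E)%E.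

(** Keeps [c * lam] in the quadratic range, with [H (c * lam) <= 1/16], below the threshold 1/8 of
    [log_laplace_init]. *)
Let lam := Num.min (2 * t0) 2^-1 / c.

Let lam_gt0 : 0 < lam.
Proof.
have t0P := t0_gt0.
by rewrite divr_gt0 // lt_min mulr_gt0 //= invr_gt0.
Qed.

Let A' := A / (1 - 2 * 2^-1 `^ alpha).

Section Coordinate.
(* [sgn = 1] treats the right tail and [sgn = -1] the left one. *)
Variables (sgn z : R).
Hypothesis sgn1 : `|sgn| = 1.

Let Z (x : R) := soft_pos (sgn * x - z).
Let B : set R := [set x | z < sgn * x].
Let p := fine (mu B).

Lemma coordinate_lip (x y : R) : `|Z x - Z y| <= `|x - y|.
Proof.
have dL (v : R) : `|dsoft_pos v| <= 1.
  by have /andP[d0 d1] := dsoft_pos_bound v; rewrite ger0_norm.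
apply: (le_trans (tangent_bounded_lipschitz (@soft_pos_tangent R) dL _ _)).
by rewrite mul1r opprB addrA subrK -mulrBr normrM sgn1 mul1r.
Qed.

Let Z_off (x : R) : ~ B x -> Z x = 0.
Proof.
move=> /negP; rewrite -leNgt => xz; rewrite /Z soft_pos_le0 //.
by rewrite subr_le0.
Qed.

Let mlin : measurable_fun setT (fun x : R => sgn * x).
Proof. exact: measurable_funM. Qed.

Let mB : measurable B. Proof. exact: measurable_superlevel. Qed.

Lemma measurable_coordinate : measurable_fun setT Z.
Proof.
have ms : measurable_fun setT (@soft_pos R).
  apply: continuous_measurable_fun; apply: derivable_continuousR => x.
  by have [] := is_derive_soft_pos x.
have mm : measurable_fun setT (fun x : R => sgn * x - z).
  exact: measurable_funB.
exact: (measurableT_comp ms mm).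
Qed.

(** The slope of the test function is at most [l] in absolute value and vanishes off B, so the
    energy integrand is at most [H (c * l)] times [expR (l * Z)] minus the indicator of the
    complement of B. *)
Lemma laplace_log_sobolev (l : R) : 0 < l ->
  laplace_deriv mu Z l - laplace mu Z l * ln (laplace mu Z l) <=
  H (c * l) * (laplace mu Z l - (1 - p)).
Proof.
move=> l0.
pose phi x := l * soft_pos (sgn * x + - z).
have sphi : smooth phi by apply: smooth_affine; exact: smooth_soft_pos.
pose dphi x := l * sgn * dsoft_pos (sgn * x - z).
have dphiE : derive1 phi = dphi.
  apply/funext => x; apply: is_derive1E.
  have dl : is_derive x (1 : R) (fun x : R => sgn * x + - z) sgn.
    apply: (is_derive_eq (is_deriveD (is_deriveZ sgn (is_derive_id x 1))
      (is_derive_cst (- z) x 1))).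
    by rewrite addr0 -[LHS]/(_ * _) mulr1.
  have dc : is_derive x (1 : R) (fun x : R => soft_pos (sgn * x + - z))
      (dsoft_pos (sgn * x - z) * sgn).
    exact (@is_derive1_comp R (@soft_pos R) (fun x : R => sgn * x - z) x
        (dsoft_pos (sgn * x - z)) sgn (is_derive_soft_pos _) dl).
  apply: (is_derive_eq (is_deriveZ l dc)).
  by rewrite -[LHS]/(_ * _) /dphi; ring.
have tg x y : phi x + dphi x * (y - x) <= phi y.
  have := soft_pos_tangent (sgn * x - z) (sgn * y - z).
  rewrite -(ler_pM2l l0) mulrDr /phi /dphi; apply: le_trans.
  by rewrite le_eqVlt; apply/orP; left; apply/eqP; ring.
have lphi : lipschitz phi.
  apply: (@lipschitz_of_bound _ _ l) => x y.
  by rewrite -mulrBr normrM (gtr0_norm l0) ler_wpM2l ?(ltW l0) ?coordinate_lip.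
have := log_sobolev sphi (tangent_convex tg) lphi.
have soft_ge0 x : 0 <= Z x by exact: soft_pos_ge0.
rewrite (Ent_laplace exp_moment coordinate_lip measurable_coordinate l0) dphiE.
move=> /le_trans ent.
have I1 : mu.-integrable setT (EFin \o (fun x => expR (l * Z x))).
  apply: (integrable_expR_lipschitz exp_moment
    (measurable_funM _ measurable_coordinate) l0) => //.
  by move=> x y; rewrite -mulrBr normrM (gtr0_norm l0) ler_wpM2l ?(ltW l0)
    ?coordinate_lip.
have mBC : measurable (~` B) by exact: measurableC.
have I2 := integrable_indicR mu mBC.
have I12 : mu.-integrable setT
    (EFin \o (fun x => expR (l * Z x) - (\1_(~` B) x : R))).
  exact: (integrableB measurableT I1 I2).
have I3 : mu.-integrable setT
    (EFin \o (fun x => H (c * l) * (expR (l * Z x) - (\1_(~` B) x : R)))).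
  exact: (@integrableZl _ _ _ mu setT measurableT _ _ I12).
rewrite -lee_fin; apply: ent.
have -> : H (c * l) * (laplace mu Z l - (1 - p)) =
    \int[mu]_x (H (c * l) * (expR (l * Z x) - (\1_(~` B) x : R))).
  rewrite (RintegralZl _ measurableT I12) (RintegralB measurableT I1 I2).
  by rewrite Rintegral_indic // probability_setC // [mu B]probability_fin.
rewrite -(integralR I3).
have mH : measurable_fun setT H.
  by apply: continuous_measurable_fun; exact: convex_fun_continuous.
have mdphi : measurable_fun setT dphi.
  rewrite -dphiE; apply: continuous_measurable_fun.
  by apply: derivable_continuousR => x; exact: (sphi 1%N).
have mF : measurable_fun setT (fun x => H (c * dphi x) * expR (phi x)).
  apply: measurable_funM.
    have mm : measurable_fun setT (fun x => c * dphi x) by exact: measurable_funM.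
    exact: (measurableT_comp mH mm).
  have mm : measurable_fun setT phi by exact: (measurable_funM _ measurable_coordinate).
  exact: (measurableT_comp (@measurable_expR R) mm).
apply: ge0_le_integral => //.
- by move=> x _; rewrite lee_fin mulr_ge0 ?expR_ge0.
- exact: (measurable_EFin_comp mF).
- by have /integrableP[] := I3.
move=> x _; rewrite lee_fin indicE.
have [xB|xB] := boolP (x \in ~` B).
  rewrite inE in xB; have xz : sgn * x - z <= 0.
    by rewrite subr_le0 leNgt; apply/negP.
  rewrite /dphi (dsoft_pos_le0 xz) (Z_off xB) !mulr0 (cost0 t0_gt0 H_near0).
  by rewrite mul0r expR0 subrr mulr0.
rewrite subr0 ler_wpM2r ?expR_ge0 //.
apply: (cost_mono H_ge0 H_even H_convex t0_gt0 H_near0).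
have /andP[d0 d1] := dsoft_pos_bound (sgn * x - z).
rewrite /dphi !normrM sgn1 mulr1 (ger0_norm d0) ler_wpM2l // ler_piMr //.
Qed.

(** Halving [n] times brings [l] below [lam], where the value is at most 2; [n] is minimal enough
    that [2 ^+ n <= 1 + 2 * (l / lam)]. *)
Lemma log_laplace_le (l : R) : 0 < p -> p <= 2^-1 -> 0 < l ->
  log_laplace mu Z B l <= 2 * (1 + 2 * (l / lam)) +
    A' * H (c * l).
Proof.
move=> p0 p1 l0; have lam0 := lam_gt0.
have m0 : 0 < Num.min (2 * t0) 2^-1 by rewrite lt_min mulr_gt0 //= invr_gt0.
have Zge0 x : 0 <= Z x by exact: soft_pos_ge0.
have Hlam : H (c * lam) <= 8^-1.
  have -> : c * lam = Num.min (2 * t0) 2^-1.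
    by rewrite /lam mulrCA divff ?mulr1 // gt_eqF.
  rewrite H_near0; last first.
    by rewrite (le_trans _ (ltW m0)) ?ge_min ?lexx // oppr_le0 mulr_ge0 // ltW.
  have : Num.min (2 * t0) 2^-1 ^+ 2 <= 2^-1 ^+ 2.
    by rewrite ler_sqr ?nnegrE ?(ltW m0) ?invr_ge0 // ge_min lexx orbT.
  by lra.
have init : log_laplace mu Z B lam <= 2.
  exact: (log_laplace_init exp_moment Zge0 coordinate_lip
    measurable_coordinate mB Z_off p0 p1 laplace_log_sobolev lam0 Hlam).
have half := log_laplace_half exp_moment Zge0 coordinate_lip
  measurable_coordinate mB Z_off p0 p1 laplace_log_sobolev.
have [n /andP[n1 n2]] := pow2_between (divr_gt0 l0 lam0).
have tn : (0 : R) < 2 ^+ n by rewrite exprn_gt0.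
apply: (le_trans (doubling_iter (h := fun l => H (c * l)) n half l0)).
apply: lerD.
  have ln : l / 2 ^+ n <= lam.
    by rewrite ler_pdivrMr // -ler_pdivrMl // mulrC.
  have mono := log_laplace_mono exp_moment Zge0 coordinate_lip
    measurable_coordinate mB p0 (divr_gt0 l0 tn) ln.
  apply: (@le_trans _ _ (2 ^+ n * 2)).
    exact: (ler_wpM2l (ltW tn) (le_trans mono init)).
  by rewrite mulrC ler_wpM2l.
have := cost_dyadic_sum H_ge0 A_ge1 alpha_gt1 H_growth n (c * l).
apply: le_trans; rewrite le_eqVlt; apply/orP; left; apply/eqP.
by apply: eq_bigr => i _; rewrite mulrA.
Qed.

End Coordinate.

Lemma quantile_increment_le : exists2 M, 0 < M &
  forall (sgn : R) (u : R -> R), `|sgn| = 1 -> exp_quantiles mu (fun x => sgn * x) u ->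
  forall x h : R, 0 <= x -> 0 < h ->
    u (x + h) - u x <= M * inv_nonneg (legendre H) (t0 ^+ 2 + h).
Proof.
have lam0 := lam_gt0; have t0P := t0_gt0; have A1 := A_ge1.
have [q0 q1] := half_powR_bound alpha_gt1.
have A'0 : 0 < A' by rewrite divr_gt0 //; lra.
pose M := (1 + 4 / lam) * (2 / t0) + A' * c / Num.min 1 (t0 ^+ 2 / 2).
have M0 : 0 < M.
  have k0 : 0 < Num.min 1 (t0 ^+ 2 / 2) by rewrite lt_min ltr01 divr_gt0 // exprn_gt0.
  have il : 0 < 4 / lam by rewrite divr_gt0.
  have e1 : 0 < 1 + 4 / lam by lra.
  apply: addr_gt0; first by rewrite mulr_gt0 // divr_gt0.
  by rewrite divr_gt0 // mulr_gt0.
exists M => // sgn u sgn1 uQ x h x0 h0.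
(* A strict increase is needed for S to lie inside B below. *)
have [dneg|dpos] := leP (u (x + h)) (u x).
  apply: (@le_trans _ _ 0); first by rewrite subr_le0.
  apply: mulr_ge0; first exact: ltW.
  apply: le_trans (legendre_inv_ge H_ge0 H_even H_convex t0_gt0 H_near0
    legendre_superlinear (ltW h0)).
  by rewrite divr_ge0 // ltW.
apply: (dual_bound H_ge0 H_even H_convex t0_gt0 H_near0 legendre_superlinear
  A_ge1 alpha_gt1 c_gt0 lam0 h0) => l l0.
have [hB _] := uQ x x0; have [_ hS] := uQ (x + h) (addr_ge0 x0 (ltW h0)).
pose B : set R := [set y | u x < sgn * y].
pose S : set R := [set y | u (x + h) <= sgn * y].
have mlin : measurable_fun setT (fun x : R => sgn * x) by exact: measurable_funM.
have mB : measurable B by exact: measurable_superlevel.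
have mS : measurable S by exact: measurable_superlevel_ge.
have SB : S `<=` B by move=> y; exact: lt_le_trans.
have leSB : fine (mu S) <= fine (mu B).
  by rewrite -lee_fin -!probability_fin //; apply: le_measure; rewrite ?inE.
rewrite [X in (X <= _)%E](probability_fin mu mB) lee_fin in hB.
rewrite [X in (_ <= X)%E](probability_fin mu mS) lee_fin in hS.
have ex : expR (- x) <= 1 by rewrite -expR0 ler_expR oppr_le0.
have exh := expR_gt0 (- (x + h)).
have p1 : fine (mu B) <= 2^-1 by lra.
have p0 : 0 < fine (mu B) by lra.
have main := log_laplace_le sgn1 p0 p1 l0.
apply: le_trans main.
(* B is open and S closed, so atoms only help: they lower [mu B] and raise [mu S] relative to the
   exponential values. *)
have ratio : expR (- h) * fine (mu B) <= fine (mu S).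
  apply: le_trans (ler_wpM2l (expR_ge0 (- h)) hB) _.
  suff -> : expR (- h) * (expR (- x) / 2) = expR (- (x + h)) / 2 by [].
  by rewrite opprD expRD; ring.
pose Z y := soft_pos (sgn * y - u x).
have Z_ge0 y : 0 <= Z y by exact: soft_pos_ge0.
have SZ y : S y -> B y /\ u (x + h) - u x - 1 <= Z y.
  move=> yS; split; first exact: SB.
  apply: le_trans (soft_pos_ge _); rewrite lerD2r lerD2r; exact: yS.
have chernoff := laplace_chernoff exp_moment Z_ge0 (@coordinate_lip sgn (u x) sgn1)
  (@measurable_coordinate sgn (u x)) mB mS l0 SZ.
rewrite /log_laplace.
have e0 := expR_gt0 (l * (u (x + h) - u x - 1) - h).
have : expR (l * (u (x + h) - u x - 1) - h) <=
    (laplace mu Z l - (1 - fine (mu B))) / fine (mu B).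
  rewrite ler_pdivlMr // expRD -mulrA; apply: le_trans chernoff.
  by rewrite ler_wpM2l ?expR_ge0.
move=> le1; rewrite -ler_expR lnK ?posrE //; exact: lt_le_trans le1.
Qed.

End ConvexLogSobolevToDelta.

(** The factor 2 is for intervals that straddle 0: they are cut there, and each piece is bounded
    through its own tail. *)
Lemma Delta_le {R : realType} (mu : probability R R) (iota : R -> R) (M : R) :
  (forall h, 0 < h -> 0 <= M * iota h) ->
  (forall h h', 0 < h -> h <= h' -> M * iota h <= M * iota h') ->
  (forall x h, 0 <= x -> 0 < h -> U_map mu (x + h) - U_map mu x <= M * iota h) ->
  (forall x h, 0 <= x -> 0 < h ->
    U_map mu (- x) - U_map mu (- (x + h)) <= M * iota h) ->
  forall h, 0 < h -> (Delta mu h <= (2 * M * iota h)%:E)%E.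
Proof.
move=> iota0 iota_mono right left h h0.
apply: ge_ereal_sup => _ [x _ <-]; rewrite lee_fin -mulrA.
have pos := iota0 h h0.
have [x0|x0] := leP 0 x; first by have := right x h x0 h0; lra.
have [xh|xh] := leP (x + h) 0.
  have xh' : 0 <= - (x + h) by rewrite oppr_ge0.
  have := left _ _ xh' h0; rewrite (opprK (x + h)).
  by rewrite (_ : - (- (x + h) + h) = x); [lra|ring].
have nx : 0 < - x by rewrite oppr_gt0.
have r0 := right 0 (x + h) (lexx 0) xh; rewrite add0r in r0.
have l0 := left 0 (- x) (lexx 0) nx; rewrite add0r (opprK x) oppr0 in l0.
have m1 := iota_mono (x + h) h xh; have m2 := iota_mono (- x) h nx.
have {}m1 : M * iota (x + h) <= M * iota h by apply: m1; lra.
have {}m2 : M * iota (- x) <= M * iota h by apply: m2; lra.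
lra.
Qed.

Theorem theorem1p1 (R : realType) (H : R -> R) (t0 A alpha : R) :
  (forall x, 0 <= H x) ->
  (forall x, H (- x) = H x) ->
  convex_fun H ->
  0 < t0 ->
  (forall x, - (2 * t0) <= x <= 2 * t0 -> H x = 4^-1 * x ^+ 2) ->
  ((fun x => legendre H x / x) x @[x --> +oo] --> +oo) ->
  1 <= A -> 1 < alpha <= 2 ->
  (forall x s, 0 <= s <= 1 -> H (s * x) <= A * s `^ alpha * H x) ->
  forall mu : probability R R,
    ((forall s : R, 0 < s -> (\int[mu]_x (expR (s * `|x|))%:E < +oo)%E) /\
     exists c : R, 0 < c /\
       forall phi : R -> R, smooth phi -> convex_fun phi -> lipschitz phi ->
         (Ent mu (fun x => expR (phi x))
          <= \int[mu]_x (H (c * derive1 phi x) * expR (phi x))%:E)%E)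
    <->
    (exists b : R, 0 < b /\
       forall h : R, 0 < h ->
         (Delta mu h <= (b^-1 * inv_nonneg (legendre H) (t0 ^+ 2 + h))%:E)%E).
Proof.
move=> H_ge0 H_even H_convex t0_gt0 H_near0 superlinear A_ge1 /andP[alpha_gt1 _].
move=> H_growth mu; split; last first.
  move=> [b [b_gt0 hD]]; split.
    exact: (Delta_exp_moment H_ge0 H_even t0_gt0 H_near0 superlinear b_gt0 hD).
  exact: (Delta_entropy_bound H_ge0 H_even H_convex t0_gt0 H_near0 superlinear
    b_gt0 hD).
move=> [exp_moment [c [c_gt0 log_sobolev]]].
have [M M_gt0 incr] := quantile_increment_le H_ge0 H_even H_convex t0_gt0
  H_near0 superlinear A_ge1 alpha_gt1 H_growth c_gt0 exp_moment log_sobolev.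
exists (2 * M)^-1; split; first by rewrite invr_gt0 mulr_gt0.
have t02 : 0 < t0 ^+ 2 by rewrite exprn_gt0.
have inv h : 0 < h -> 0 <= inv_nonneg (legendre H) (t0 ^+ 2 + h) /\
    legendre H (inv_nonneg (legendre H) (t0 ^+ 2 + h)) = t0 ^+ 2 + h.
  move=> h0; have th : 0 <= t0 ^+ 2 + h by lra.
  exact: (legendre_inv H_ge0 H_even t0_gt0 H_near0 superlinear th).
rewrite invrK; apply: (@Delta_le _ mu
  (fun h => inv_nonneg (legendre H) (t0 ^+ 2 + h)) M).
- by move=> h /inv[i0 _]; rewrite mulr_ge0 // ltW.
- move=> h h' h0 hh; apply: ler_wpM2l; first exact: ltW.
  have [_ ih] := inv h h0.
  by apply: (le_legendre_inv H_ge0 H_even t0_gt0 H_near0 superlinear);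
    rewrite ?ih; lra.
- have uQ : exp_quantiles mu (fun x => 1 * x) (U_map mu).
    rewrite (_ : (fun x => 1 * x) = id); last by apply/funext => x; rewrite mul1r.
    by move=> x x0; exact: U_map_tail.
  by move=> x h; apply: incr uQ _ _; rewrite normr1.
- have uQ : exp_quantiles mu (fun x => -1 * x) (fun x => - U_map mu (- x)).
    rewrite (_ : (fun x => -1 * x) = -%R); last by apply/funext => x; rewrite mulN1r.
    by move=> x x0; exact: U_map_tail_opp.
  move=> x h x0 h0; have := incr (-1) _ _ uQ x h x0 h0.
  by rewrite normrN normr1 => /(_ erefl); lra.
Qed.
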